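(* Let $R$ be an associative unital ring, let $\kappa\geq\operatorname{card}(R)+\aleph_0$ be a cardinal, let $\mathcal{D}$ be a $\kappa^+$-deconstructible class of right $R$-modules that is closed under direct summands, and let $\mathcal{M}$ be either the class of all embeddings, all RD-embeddings, or all pure embeddings. Then $(\mathcal{D},\leq_{\mathcal{M}})$ is an abstract elementary class of modules if and only if $\mathcal{D}$ is closed under direct limits in the category of right $R$-modules. In particular, whether or not $(\mathcal{D},\leq_{\mathcal{M}})$ is an abstract elementary class does not depend on which of the three choices of $\mathcal{M}$ is made.
   Context: Modules are right $R$-modules; $\|M\|$ denotes the cardinality of a module $M$. For an infinite cardinal $\mu$, a module is $<\mu$-presented if it has a presentation with fewer than $\mu$ generators and fewer than $\mu$ relations. For a class $\mathcal{C}$ of modules, a module $M$ is $\mathcal{C}$-filtered if there are an ordinal $\delta$ and an increasing chain of submodules $(M_i\mid i\leq\delta)$ of $M$ with $M_0=0$, $M_\delta=M$, $M_i=\bigcup_{j<i}M_j$ for limit $i\leq\delta$, and $M_{i+1}/M_i$ isomorphic to a member of $\mathcal{C}$ for all $i<\delta$. A class $\mathcal{D}$ is $\mu$-deconstructible if $\mathcal{D}$ is exactly the class of all $\mathcal{D}^{<\mu}$-filtered modules, where $\mathcal{D}^{<\mu}$ is the class of all $<\mu$-presented modules in $\mathcal{D}$. $\mathcal{D}$ is closed under direct limits if every direct limit of a direct system (over a directed poset) of modules from $\mathcal{D}$ with arbitrary connecting homomorphisms lies in $\mathcal{D}$. An embedding is a monomorphism. A submodule $N$ of $M$ is an RD-submodule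 if $N\cap Mr=Nr$ for all $r\in R$; it is a pure submodule if every finite system of $R$-linear equations with right-hand side in $N$ that is solvable in $M$ is solvable in $N$. An RD-embedding (pure embedding) is a monomorphism whose image is an RD-submodule (pure submodule) of its codomain. For $A,B\in\mathcal{D}$, $A\leq_{\mathcal{M}}B$ means that $A$ is a submodule of $B$ and the inclusion is in $\mathcal{M}$. An abstract class of modules is a pair $\mathbf{A}=(\mathcal{A},\lesssim)$ with $\mathcal{A}$ a class of modules and $\lesssim$ a partial order on $\mathcal{A}$ such that $A\lesssim B$ implies $A$ is a submodule of $B$, and both $\mathcal{A}$ and $\lesssim$ are closed under isomorphisms. A chain $(A_i\mid i<\delta)$ indexed by an ordinal is continuous $\lesssim$-increasing if $A_i\lesssim A_j$ for $i\leq j<\delta$ and $A_i=\bigcup_{j<i}A_j$ for limit $i<\delta$. $\mathbf{A}$ is an abstract elementary class (AEC) of modules if: (A1) Tarski--Vaught Axioms: for every continuous $\lesssim$-increasing chain $(A_i\mid i<\delta)$ in $\mathcal{A}$: (1) $\bigcup_{i<\delta}A_i\in\mathcal{A}$; (2) $A_j\lesssim\bigcup_{i<\delta}A_i$ for each $j<\delta$; (3) if $M\in\mathcal{A}$ and $A_i\lesssim M$ for each $i<\delta$, then $\bigcup_{i<\delta}A_i\lesssim M$. (A2) Coherence: if $A,B,C\in\mathcal{A}$, $A\lesssim C$, $B\lesssim C$, and $A$ is a submodule of $B$, then $A\lesssim B$. (A3) L\''owenheim--Skolem--Tarski Axiom: there is a cardinal $\lambda$ such that whenever $A$ is a submodule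 of $B\in\mathcal{A}$ there is $A'\in\mathcal{A}$ with $A\subseteq A'\lesssim B$ and $\|A'\|\leq\|A\|+\lambda$. *)

(* Defs.v *)
From HB Require Import structures.
From mathcomp Require Import all_boot all_order all_algebra.
From mathcomp Require Import all_classical.
From mathcomp Require wochoice.

Set Implicit Arguments.
Unset Strict Implicit.
Unset Printing Implicit Defensive.

Import GRing.Theory.
Local Open Scope ring_scope.
Local Open Scope classical_set_scope.
Local Open Scope card_scope.

(** * Sets and cardinals

    A class of modules is a predicate on [lmodType].  "Sets" (cardinals,
    ordinals, index sets) live in the universe of the carriers of modules:
    in a larger universe, "there is a cardinal lambda" would be too weak and
    "for all kappa" would be too strong.
    A cardinal is given by any set of that cardinality. *)
Definition small := Type@{GRing.Lmodule.axioms_.u0}.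

Definition card_lt (X Y : small) : Prop :=
  [set: X] #<= [set: Y] /\ ~ ([set: Y] #<= [set: X]).

Definition is_succ_card (K L : small) : Prop :=
  card_lt K L /\ forall X : small, card_lt K X -> [set: L] #<= [set: X].

(** * Ordinals, as well-orders (given by the reflexive relation [le]) *)
Section Ordinals.
Variables (I : small) (le : rel I).

(* the strict order, since [le] will be total and antisymmetric *)
Definition olt (i j : I) : bool := ~~ le j i.

Definition is_least (i : I) : Prop := forall j, le i j.

Definition is_succ (i j : I) : Prop := olt i j /\ forall k, olt i k -> le j k.

(* 0 is not a limit *)
Definition is_limit (i : I) : Prop :=
  (exists j, olt j i) /\ forall j, ~ is_succ j i.

End Ordinals.

(** * Right modules

    A right R-module is a left module over the opposite ring [R^c]: for
    [x : M] and [r : R], the element x r is written [(r : R^c) *: x]. *)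
Notation rmodType R := (lmodType R^c).

Definition isomorphic (R : pzRingType) (A B : rmodType R) : Prop :=
  exists f : {linear A -> B}, bijective f.

(** ** A submodule, as a module *)
Section Submodule.
Variables (R : pzRingType) (U : rmodType R) (A : submodClosed U).

Record smod := Smod { smod_val : U; _ : smod_val \in A }.

HB.instance Definition _ := [isSub for smod_val].
HB.instance Definition _ := [Choice of smod by <:].
HB.instance Definition _ := [SubChoice_isSubLmodule of smod by <:].

Definition smod_incl : {linear smod -> U} := (val : {linear smod -> U}).

End Submodule.

(** ** For submodules [A] and [B] of [U], the submodule [A] of the module [B]
    (their intersection, when [A] is not included in [B]) *)
Section Inside.
Variables (R : pzRingType) (U : rmodType R) (B A : submodClosed U).

Definition inside : {pred smod B} := [pred x | val x \in A].

Fact inside_submod_closed : subsemimod_closed inside.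
Proof.
apply: GRing.submod_closed_semi; split=> [|r x y].
  by rewrite inE raddf0 rpred0.
by rewrite !inE => xA yA; rewrite linearP rpredD ?rpredZ.
Qed.

HB.instance Definition _ :=
  GRing.isSubmodClosed.Build R^c (smod B) inside inside_submod_closed.

End Inside.

Arguments inside {R U} B A _.

(** ** The quotient of a module by a submodule *)
Section QuotientModule.
Variables (R : pzRingType) (U : rmodType R) (N : submodClosed U).

(* the library's quotient of additive groups asks for [zmodClosed] *)
Definition zsub : {pred U} := [pred x | x \in N].

Fact zsub_zmod_closed : zmod_closed zsub.
Proof.
split=> [|x y]; first by rewrite inE rpred0.
by rewrite !inE => xN yN; rewrite -scaleN1r rpredD ?rpredZ.
Qed.

HB.instance Definition _ := GRing.isZmodClosed.Build U zsub zsub_zmod_closed.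

Definition qmod := Quotient.quot zsub.

HB.instance Definition _ := GRing.Zmodule.on qmod.

Definition qmod_scale (r : R^c) (x : qmod) : qmod :=
  \pi_(qmod)%qT (r *: repr x).

Fact qmod_piD (x y : U) :
  \pi_(qmod)%qT (x + y) = \pi_(qmod)%qT x + \pi_(qmod)%qT y.
Proof. exact: Quotient.pi_add. Qed.

Fact qmod_scale_pi r (x : U) :
  qmod_scale r (\pi_(qmod)%qT x) = \pi_(qmod)%qT (r *: x).
Proof.
apply/eqP; rewrite -Quotient.idealrBE inE -scalerBr rpredZ //.
have: repr (\pi_(qmod)%qT x) - x \in zsub by rewrite Quotient.idealrBE reprK.
by rewrite inE.
Qed.

Fact qmod_scalerA a b x :
  qmod_scale a (qmod_scale b x) = qmod_scale (a * b) x.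
Proof. by rewrite -[x]reprK (qmod_scale_pi b) !qmod_scale_pi scalerA. Qed.

Fact qmod_scale1r : left_id 1 qmod_scale.
Proof. by move=> x; rewrite -[x]reprK qmod_scale_pi scale1r. Qed.

Fact qmod_scalerDr : right_distributive qmod_scale +%R.
Proof.
move=> a x y; rewrite -[x]reprK -[y]reprK -qmod_piD.
by rewrite !qmod_scale_pi scalerDr qmod_piD.
Qed.

Fact qmod_scalerDl x : {morph qmod_scale^~ x : a b / a + b}.
Proof.
move=> a b; rewrite -[x]reprK !qmod_scale_pi.
by rewrite scalerDl qmod_piD.
Qed.

HB.instance Definition _ := GRing.Zmodule_isLmodule.Build R^c qmod
  qmod_scalerA qmod_scale1r qmod_scalerDr qmod_scalerDl.

End QuotientModule.

(** ** The free module on a set: the functions with finite support *)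
Section FreeModule.
Variables (R : pzRingType) (X : small).

Definition finsupp : {pred (X -> R^c^o)} :=
  [pred f | `[< finite_set [set x | f x != 0] >]].

Fact finsupp_submod_closed : subsemimod_closed finsupp.
Proof.
apply: GRing.submod_closed_semi; split=> [|r f g].
  have e : [set x : X | (0 : X -> R^c^o) x != 0] = set0.
    by apply/seteqP; split=> x //=; rewrite eqxx.
  by rewrite inE e; exact: finite_set0.
rewrite !inE => ff fg.
apply: (@sub_finite_set _ _ ([set x | f x != 0] `|` [set x | g x != 0])).
  move=> x /= nz; have [fx0|] := eqVneq (f x) 0; last by left.
  right; apply: contraNN nz => /eqP gx0.
  have -> : (r *: f + g) x = r *: f x + g x by [].
  by rewrite fx0 gx0 scaler0 addr0.
by rewrite finite_setU.
Qed.

HB.instance Definition _ :=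
  GRing.isSubmodClosed.Build R^c (X -> R^c^o) finsupp finsupp_submod_closed.

Definition free_mod : rmodType R := smod finsupp.

End FreeModule.

Section Classes.
Variable R : pzRingType.
Implicit Types (C D : rmodType R -> Prop).

(** * Deconstructible classes *)

(* an exact sequence R^(Y) -> R^(X) -> M -> 0 with |X|, |Y| < mu *)
Definition lt_presented (mu : small) (M : rmodType R) : Prop :=
  exists X Y : small, card_lt X mu /\ card_lt Y mu /\
  exists (f : {linear free_mod R Y -> free_mod R X})
         (g : {linear free_mod R X -> M}),
    (forall z, exists x, g x = z) /\
    (forall x, g x = 0 <-> exists y, f y = x).

(* the well-order [le], with a greatest element [top], stands for the ordinals
   i <= delta *)
Definition filtered C (M : rmodType R) : Prop :=
  exists (I : small) (le : rel I) (top : I) (A : I -> submodClosed M),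
    [/\ wochoice.well_order le /\ (forall i, le i top),
        (forall i j, le i j -> {subset A i <= A j}),
        (forall i, is_least le i -> forall x, x \in A i <-> x = 0) /\
        (forall x, x \in A top),
        (forall i, is_limit le i ->
           forall x, x \in A i <-> exists2 j, olt le j i & x \in A j) &
        (forall i j, is_succ le i j ->
           exists2 N, C N & isomorphic (qmod (inside (A j) (A i))) N)].

Definition deconstructible (mu : small) D : Prop :=
  forall M, D M <-> filtered (fun N => lt_presented mu N /\ D N) M.

(** * Closure properties *)

Definition closed_direct_summands D : Prop :=
  forall M A B : rmodType R, isomorphic M (A * B)%type -> D M -> D A.

Record direct_system (I : small) (le : rel I) (M : I -> rmodType R)
    (f : forall i j, le i j -> {linear M i -> M j}) : Prop := {
  dsys_poset : wochoice.partial_order le;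
  dsys_nonempty : exists i : I, True;
  dsys_directed : forall i j, exists k, le i k /\ le j k;
  dsys_id : forall i (h : le i i) x, f i i h x = x;
  dsys_comp : forall i j k (hij : le i j) (hjk : le j k) (hik : le i k) x,
    f j k hjk (f i j hij x) = f i k hik x }.

Definition is_direct_limit (I : small) (le : rel I) (M : I -> rmodType R)
    (f : forall i j, le i j -> {linear M i -> M j})
    (L : rmodType R) (phi : forall i, {linear M i -> L}) : Prop :=
  (forall i j (h : le i j) x, phi j (f i j h x) = phi i x) /\
  forall (N : rmodType R) (psi : forall i, {linear M i -> N}),
    (forall i j (h : le i j) x, psi j (f i j h x) = psi i x) ->
    exists u : {linear L -> N}, (forall i x, u (phi i x) = psi i x) /\
      forall v : {linear L -> N}, (forall i x, v (phi i x) = psi i x) -> v =1 u.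

Definition closed_direct_limits D : Prop :=
  forall (I : small) (le : rel I) (M : I -> rmodType R)
    (f : forall i j, le i j -> {linear M i -> M j})
    (L : rmodType R) (phi : forall i, {linear M i -> L}),
  direct_system f -> is_direct_limit f phi -> (forall i, D (M i)) -> D L.

(** * Three classes of monomorphisms *)

Definition RD_submodule (M : rmodType R) (N : set M) : Prop :=
  forall r : R, N `&` [set (r : R^c) *: x | x in setT] =
                [set (r : R^c) *: x | x in N].

(* the i-th equation of a system is: sum over j of x_j a_ij = b_i *)
Definition pure_submodule (M : rmodType R) (N : set M) : Prop :=
  forall (m n : nat) (a : 'M[R]_(m, n)) (b : 'I_m -> M),
    (forall i, N (b i)) ->
    (exists x : 'I_n -> M,
       forall i, \sum_(j < n) (a i j : R^c) *: x j = b i) ->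
    exists x : 'I_n -> M, (forall j, N (x j)) /\
       forall i, \sum_(j < n) (a i j : R^c) *: x j = b i.

Inductive embedding_kind := AllEmbeddings | RDEmbeddings | PureEmbeddings.

Definition embedding (k : embedding_kind) (A B : rmodType R)
    (f : {linear A -> B}) : Prop :=
  injective f /\
  match k with
  | AllEmbeddings => True
  | RDEmbeddings => RD_submodule (range f)
  | PureEmbeddings => pure_submodule (range f)
  end.

(** * Abstract elementary classes

    A relation [A <~ B] implying that A is a submodule of B is given by a
    predicate [strong] on the modules [B] with a submodule [A]. *)
Definition submod_rel := forall B : rmodType R, submodClosed B -> Prop.

Definition le_emb D (k : embedding_kind) : submod_rel :=
  fun B A => [/\ D (smod A), D B & embedding k (smod_incl A)].

Section AEC.
Variables (mem : rmodType R -> Prop) (strong : submod_rel).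

(* [A <~ B] for two modules [A] and [B] that are submodules of some [U]; in
   chains and in triples of modules below, [U] is a module containing all the
   modules at hand *)
Definition strong_in (U : rmodType R) (A B : submodClosed U) : Prop :=
  {subset A <= B} /\ strong (inside B A).

Record abstract_class : Prop := {
  ac_mem_iso : forall A B, isomorphic A B -> mem A -> mem B;
  ac_strong_mem : forall (B : rmodType R) (A : submodClosed B),
    strong A -> mem (smod A) /\ mem B;
  ac_strong_iso : forall (B B' : rmodType R) (A : submodClosed B)
      (A' : submodClosed B') (f : {linear B -> B'}),
    bijective f -> (forall x, (f x \in A') = (x \in A)) ->
    strong A -> strong A';
  ac_refl : forall (U : rmodType R) (A : submodClosed U),
    mem (smod A) -> strong_in A A;
  ac_antisym : forall (U : rmodType R) (A B : submodClosed U),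
    strong_in A B -> strong_in B A -> A =i B;
  ac_trans : forall (U : rmodType R) (A B C : submodClosed U),
    strong_in A B -> strong_in B C -> strong_in A C }.

(* the well-order [le] is the ordinal delta *)
Record continuous_chain (U : rmodType R) (I : small) (le : rel I)
    (A : I -> submodClosed U) : Prop := {
  chain_wo : wochoice.well_order le;
  chain_mem : forall i, mem (smod (A i));
  chain_strong : forall i j, le i j -> strong_in (A i) (A j);
  chain_cont : forall i, is_limit le i ->
    forall x, x \in A i <-> exists2 j, olt le j i & x \in A j }.

Definition is_union (U : rmodType R) (I : small) (A : I -> submodClosed U)
    (V : submodClosed U) : Prop :=
  forall x, x \in V <-> exists i, x \in A i.

(* The union of a nonempty chain of submodules is a submodule; the empty
   chain has no union [V], as 0 belongs to [V]. *)
Definition tarski_vaught : Prop :=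
  forall (U : rmodType R) (I : small) (le : rel I) (A : I -> submodClosed U)
    (V : submodClosed U),
  continuous_chain le A -> is_union A V ->
  [/\ mem (smod V),
      (forall j, strong_in (A j) V) &
      (forall M : submodClosed U, mem (smod M) ->
         (forall i, strong_in (A i) M) -> strong_in V M)].

Definition coherence : Prop :=
  forall (U : rmodType R) (A B C : submodClosed U),
  mem (smod A) -> mem (smod B) -> mem (smod C) ->
  strong_in A C -> strong_in B C -> {subset A <= B} -> strong_in A B.

Definition lowenheim_skolem_tarski : Prop :=
  exists lambda : small,
  forall (B : rmodType R) (A : submodClosed B), mem B ->
  exists A' : submodClosed B,
    [/\ mem (smod A'), {subset A <= A'}, strong A' &
        [set: smod A'] #<= [set: (smod A + lambda)%type]].

Definition is_AEC : Prop :=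
  [/\ abstract_class, tarski_vaught, coherence & lowenheim_skolem_tarski].

End AEC.
End Classes.

(* Main.v *)
From HB Require Import structures.
Require Import Defs.
From mathcomp Require Import all_boot all_order all_algebra.
From mathcomp Require Import finmap.
From mathcomp Require Import all_classical.
From mathcomp Require wochoice.

(** The three kinds of embeddings are of finite character, so that for the
    relation [le_emb D k] the coherence axiom and the parts of the Tarski-Vaught
    axioms about strong submodules hold for any class D closed under
    isomorphisms. What remains of the axioms is that D is closed under unions of
    continuous chains of embeddings of kind k, and the Löwenheim-Skolem-Tarski
    axiom.

    From direct limits to abstract elementary classes. Unions of chains are direct
    limits. As the members of D are filtered by modules of bounded size, each
    of them has a function c, attaching boundedly many elements to each
    element, such that all its submodules closed under c belong to D
    ([filtered_closed], in the spirit of the Hill lemma). Closing a submodule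
    under c and under choices of solutions of finite systems yields a pure submodule in D, of the required size because an
    infinite set has as many finite sequences as elements ([seq_injection]).

    From abstract elementary classes to direct limits. First let the system
    (M_i), i < lambda, be well-ordered, with colimit N. Consider the tree of the
    initial parts of the elements of a product of sets Y_i, and a copy of M_i at
    each node of level i. In the product of all these copies let X be the
    submodule generated by the threads: a thread starts with an element at some
    node, follows a branch of the tree with the images of this element, and
    stops somewhere or never. Two facts are played off against each other.

    - X belongs to D. The tree is built node by node, and the module of each new
      node is reached by a chain of split embeddings, whatever the maps of the
      system ([add_node]); split embeddings are embeddings of all three
      kinds. This uses the closure under unions of chains ([build]), sums of two
      modules, and direct summands.

    - The threads that stop generate a submodule B, and X/B is a direct sum of
      copies of N, one for each branch. If the Y_i grow fast enough, then there
      are more branches than nodes ([koenig_family]), so that the closure H of B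
      under the function c of X meets only few branches. The class D contains
      X/H, and N is a direct summand of X/H ([top_summand], [chain_limit]).

    An arbitrary directed system over I reduces to well-ordered ones by a
    transfinite induction over a well-ordering of I, provided that upper bounds
    of the finite subsets of I are chosen in a monotone way ([lim_directed]).

    The second part of the theorem follows, since the closure under direct limits
    does not mention k. *)

Set Implicit Arguments.
Unset Strict Implicit.
Unset Printing Implicit Defensive.

Import GRing.Theory.
Local Open Scope ring_scope.
Local Open Scope classical_set_scope.
Local Open Scope card_scope.

(** * Linear maps, submodules, quotients and products *)

Section MkLin.
Variables (R : pzRingType) (A B : rmodType R) (g : A -> B) (gP : linear g).
Definition mklin_fun := g.
HB.instance Definition _ := GRing.isLinear.Build R^c A B _ mklin_fun gP.
Definition mklin : {linear A -> B} := mklin_fun.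
End MkLin.

Section PredSub.
Variables (R : pzRingType) (U : rmodType R) (P : U -> Prop).
Hypotheses (P0 : P 0) (Pl : forall r x y, P x -> P y -> P (r *: x + y)).
Definition psub_pred : {pred U} := fun x => `[< P x >].
Fact psub_closed : subsemimod_closed psub_pred.
Proof.
apply: GRing.submod_closed_semi; split=> [|r x y]; first by apply/asboolP.
by move=> /asboolP Px /asboolP Py; apply/asboolP; exact: Pl.
Qed.
HB.instance Definition _ := GRing.isSubmodClosed.Build R^c U psub_pred psub_closed.
(* opaque: unfolding membership would expose a bare predicate, without its
   closure properties *)
Fact psub_ex : {S : submodClosed U | forall x, x \in S <-> P x}.
Proof.
by exists (psub_pred : submodClosed U) => x; split=> /asboolP.
Qed.
Definition psub : submodClosed U := sval psub_ex.
Lemma psubE x : x \in psub <-> P x.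
Proof. exact: (svalP psub_ex). Qed.
Lemma psubP x : reflect (P x) (x \in psub).
Proof. by apply: (iffP idP) => /psubE. Qed.
End PredSub.
Arguments psubP {R U P P0 Pl x}.
Arguments psubE {R U P} P0 Pl x.

Section Basics.
Variable R : pzRingType.
Implicit Types (A B C N U : rmodType R).

Lemma iso_refl A : isomorphic A A.
Proof. by exists (mklin (g := id) (fun r x y => erefl)); exists id. Qed.

Lemma iso_sym A B : isomorphic A B -> isomorphic B A.
Proof.
move=> [f fb]; have [g fK gK] := fb.
have gl : linear g by move=> r x y; apply: (bij_inj fb); rewrite linearP !gK.
by exists (mklin gl); exists f.
Qed.

Lemma iso_trans A B C : isomorphic A B -> isomorphic B C -> isomorphic A C.
Proof.
move=> [f fb] [g gb].
have gfl : linear (g \o f) by move=> r x y; rewrite /= !linearP.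
exists (mklin gfl); exact: (bij_comp gb fb).
Qed.

Lemma inj_surj_bij (X Y : Type) (f : X -> Y) :
  injective f -> (forall y, exists x, f x = y) -> bijective f.
Proof.
move=> fi fs; have [g gK] := choice fs; exists g => // x.
by apply: fi; rewrite gK.
Qed.

Lemma isoI A B (f : {linear A -> B}) :
  (forall x, f x = 0 -> x = 0) -> (forall y, exists x, f x = y) ->
  isomorphic A B.
Proof.
move=> f0 fs; exists f; apply: inj_surj_bij => // x y fxy.
by apply/eqP; rewrite -subr_eq0; apply/eqP/f0; rewrite linearB fxy subrr.
Qed.

Lemma sub_lin U (S : submodClosed U) r x y :
  x \in S -> y \in S -> r *: x + y \in S.
Proof. by move=> xS yS; rewrite rpredD ?rpredZ. Qed.

Lemma sub_opp U (S : submodClosed U) x : x \in S -> - x \in S.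
Proof. by move=> xS; rewrite -scaleN1r rpredZ. Qed.

Lemma sub_sub U (S : submodClosed U) x y : x \in S -> y \in S -> x - y \in S.
Proof. by move=> xS yS; rewrite rpredD ?sub_opp. Qed.

Lemma smod_in U (S : submodClosed U) (x : smod S) : val x \in S.
Proof. exact: valP. Qed.

Section Corestrict.
Variables (A U : rmodType R) (S : submodClosed U) (h : {linear A -> U}).
Hypothesis hS : forall a, h a \in S.
Fact corestrict_linear : linear (fun a => Smod (hS a)).
Proof. by move=> r x y; apply: val_inj; rewrite /= !linearP. Qed.
Definition corestrict : {linear A -> smod S} := mklin corestrict_linear.
End Corestrict.

Lemma iso_range A U (S : submodClosed U) (h : {linear A -> U}) :
  (forall a, h a = 0 -> a = 0) -> (forall x, x \in S <-> exists a, h a = x) ->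
  isomorphic A (smod S).
Proof.
move=> h0 hS; have hin a : h a \in S by apply/hS; exists a.
apply: (isoI (f := corestrict hin)) => [a /(congr1 val)|y]; first exact: h0.
by have [a hay] := (hS _).1 (smod_in y); exists a; apply: val_inj.
Qed.

Lemma iso_smod_eq U (S T : submodClosed U) :
  S =i T -> isomorphic (smod S) (smod T).
Proof.
move=> ST; apply: (iso_range (h := smod_incl S)) => [a a0|x]; first exact: val_inj.
rewrite -ST; split=> [xS|[a <-]]; last exact: smod_in.
by exists (Smod xS).
Qed.

(** The submodule generated by Y is an intersection, and not a set of finite
    linear combinations: all that is needed is the induction principle. *)
Section Span.
Variables (U : rmodType R) (Y : set U).
Definition in_gensub x :=
  forall S : submodClosed U, (forall y, Y y -> y \in S) -> x \in S.
Fact in_gensub0 : in_gensub 0. Proof. by move=> S _; exact: rpred0. Qed.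
Fact in_gensubl r x y : in_gensub x -> in_gensub y -> in_gensub (r *: x + y).
Proof. by move=> xS yS S YS; apply: sub_lin; [exact: xS|exact: yS]. Qed.
Definition gensub : submodClosed U := psub in_gensub0 in_gensubl.
Lemma gensub_gen y : Y y -> y \in gensub.
Proof. by move=> Yy; apply/psubP => S; exact. Qed.
Lemma gensub_min (S : submodClosed U) :
  (forall y, Y y -> y \in S) -> {subset gensub <= S}.
Proof. by move=> YS x /psubP; exact. Qed.
Lemma gensub_ind (P : U -> Prop) : P 0 ->
  (forall r x y, P x -> P y -> P (r *: x + y)) -> (forall y, Y y -> P y) ->
  forall x, x \in gensub -> P x.
Proof.
move=> P0 Pl PY x xs; have /psubP : x \in psub P0 Pl; last by [].
by apply: gensub_min xs => y /PY Py; apply/psubP.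
Qed.
End Span.

Lemma gensub_mono U (Y Z : set U) : Y `<=` Z -> {subset gensub Y <= gensub Z}.
Proof. by move=> YZ; apply: gensub_min => y Yy; exact/gensub_gen/YZ. Qed.

Lemma gensub_linear U A (Y : set U) (f : {linear U -> A}) (S : submodClosed A) :
  (forall y, Y y -> f y \in S) -> forall x, x \in gensub Y -> f x \in S.
Proof.
move=> YS x; apply: (gensub_ind (P := fun x => f x \in S)) => // [|r y z yS zS].
  by rewrite linear0 rpred0.
by rewrite linearP sub_lin.
Qed.

Section Quot.
Variables (U : rmodType R) (N : submodClosed U).

Fact qpi_linear : linear (fun x : U => \pi_(qmod N)%qT x : qmod N).
Proof.
move=> r x y; rewrite /= qmod_piD; congr (_ + _).
by rewrite -qmod_scale_pi.
Qed.
Definition qpi : {linear U -> qmod N} := mklin qpi_linear.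

Lemma qpi_surj (q : qmod N) : exists x, qpi x = q.
Proof. by exists (repr q); rewrite [LHS]reprK. Qed.

Lemma qpi_eq0 x : (qpi x = 0) <-> (x \in N).
Proof.
rewrite -(linear0 qpi); split.
  by move/eqP; rewrite -Quotient.idealrBE inE subr0.
by move=> xN; apply/eqP; rewrite -Quotient.idealrBE inE subr0.
Qed.

Lemma qpi_eq x y : (qpi x = qpi y) <-> (x - y \in N).
Proof.
rewrite -qpi_eq0 linearB; split=> [->|/eqP]; first by rewrite subrr.
by rewrite subr_eq0 => /eqP.
Qed.

Lemma qmod_lift A (h : {linear U -> A}) : (forall x, x \in N -> h x = 0) ->
  exists f : {linear qmod N -> A}, forall x, f (qpi x) = h x.
Proof.
move=> hN; have hq x : h (repr (qpi x)) = h x.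
  apply/eqP; rewrite -subr_eq0 -linearB; apply/eqP/hN/qpi_eq.
  exact: reprK.
have fl : linear (fun q : qmod N => h (repr q)).
  move=> r x y; have [x' <-] := qpi_surj x; have [y' <-] := qpi_surj y.
  by rewrite -linearP !hq linearP.
by exists (mklin fl) => x; exact: hq.
Qed.
End Quot.

Lemma inside_in U (B A : submodClosed U) (x : smod B) :
  (x \in inside B A) = (val x \in A).
Proof. by []. Qed.

(** The successive quotients of two filtrations are compared by means of one
    linear map between the filtered modules: an inclusion, a projection or an
    isomorphism. *)
Lemma subquot_iso U A (U1 U0 : submodClosed U) (A1 A0 : submodClosed A)
    (h : {linear U -> A}) :
  (forall x, x \in U1 -> h x \in A1) ->
  (forall a, a \in A1 -> exists2 x, x \in U1 & h x - a \in A0) ->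
  (forall x, x \in U1 -> (h x \in A0) = (x \in U0)) ->
  isomorphic (qmod (inside U1 U0)) (qmod (inside A1 A0)).
Proof.
move=> h1 hs h0.
have h1' (x : smod U1) : (h \o smod_incl U1) x \in A1 by exact/h1/smod_in.
pose k : {linear smod U1 -> qmod (inside A1 A0)} :=
  qpi (inside A1 A0) \o corestrict h1'.
have kE x : k x = 0 <-> x \in inside U1 U0.
  by rewrite /= qpi_eq0 !inside_in /= h0 //; exact: smod_in.
have [f fE] := qmod_lift (fun x => (kE x).2).
apply: (isoI (f := f)) => [q|q].
  by have [x <-] := qpi_surj q; rewrite fE => /kE /qpi_eq0.
have [[a aA1] <-] := qpi_surj q; have [x xU hx] := hs a aA1.
by exists (qpi _ (Smod xU)); rewrite fE /=; apply/qpi_eq.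
Qed.

Definition zero_mod : rmodType R := free_mod R void.

Lemma zero_mod0 (x : zero_mod) : x = 0.
Proof. by apply: val_inj; apply: funext => -[]. Qed.

Lemma iso_zero A : (forall x : A, x = 0) -> isomorphic A zero_mod.
Proof.
move=> A0; apply: iso_sym.
have zl : linear (fun _ : zero_mod => 0 : A) by move=> r x y; rewrite scaler0 addr0.
apply: (isoI (f := mklin zl)) => [x _|y]; first exact: zero_mod0.
by exists 0; rewrite (A0 y).
Qed.

Lemma iso_qmod_zero U (B A : submodClosed U) :
  {subset B <= A} -> isomorphic (qmod (inside B A)) zero_mod.
Proof.
move=> BA; apply: iso_zero => q; have [x <-] := qpi_surj q.
by apply/qpi_eq0; rewrite inside_in BA ?smod_in.
Qed.

(** Modulo H, the submodule E is a copy of N on which r is a retraction. A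
    complement of this copy is the kernel of r in U/H, which is isomorphic
    to U/(H + E). *)
Lemma quotient_summand U N (H E : submodClosed U) (r : {linear U -> N}) :
  (forall x, x \in H -> r x = 0) ->
  (forall n, exists2 e, e \in E & r e = n) ->
  (forall e, e \in E -> r e = 0 -> e \in H) ->
  exists B, isomorphic (qmod H) (N * B)%type.
Proof.
move=> rH rs rE; pose HE := gensub [set x | x \in H \/ x \in E].
have HEP x : x \in HE -> exists2 e, e \in E & x - e \in H.
  apply: (gensub_ind (P := fun x => exists2 e, e \in E & x - e \in H)).
  - by exists 0; rewrite ?subr0 rpred0.
  - move=> c x1 x2 [e1 e1E h1] [e2 e2E h2].
    exists (c *: e1 + e2); first exact: sub_lin.
    have -> : c *: x1 + x2 - (c *: e1 + e2) = c *: (x1 - e1) + (x2 - e2).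
      by rewrite scalerBr opprD addrACA.
    exact: sub_lin.
  - by move=> y [yH|yE]; [exists 0 | exists y]; rewrite ?subr0 ?subrr ?rpred0.
exists (qmod HE).
have pl : linear (fun x => (r x, qpi HE x)).
  by move=> c x y; rewrite !linearP.
have [x xH|f fE] := @qmod_lift U H _ (mklin pl).
  rewrite /= /mklin_fun (rH _ xH); congr (_, _).
  by apply/qpi_eq0/gensub_gen; left.
apply: (isoI (f := f)) => [q|[n q]].
  have [x <-] := qpi_surj q; rewrite fE => -[rx0 /qpi_eq0 /HEP [e eE xeH]].
  apply/qpi_eq0; have eH : e \in H.
    apply: rE => //; have /eqP := rH _ xeH.
    by rewrite linearB /= [r x]rx0 sub0r oppr_eq0 => /eqP.
  by rewrite -(subrK e x) rpredD.
have [y <-] := qpi_surj q; have [e eE re] := rs (n - r y).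
exists (qpi H (y + e)); rewrite fE /= /mklin_fun linearD re addrC subrK.
congr (_, _); apply/qpi_eq; rewrite addrAC subrr add0r.
by apply: gensub_gen; right.
Qed.

(** The complement is the kernel of r. *)
Lemma retract_summand U (S T : submodClosed U) (r : {linear U -> U}) :
  {subset S <= T} -> (forall x, x \in T -> r x \in S) ->
  (forall x, x \in S -> r x = x) ->
  exists B, isomorphic (smod T) (smod S * B)%type.
Proof.
move=> ST rT rS; pose P x := x \in T /\ r x = 0.
have P0 : P 0 by rewrite /P rpred0 linear0.
have Pl c x y : P x -> P y -> P (c *: x + y).
  move=> [xT x0] [yT y0]; split; first exact: sub_lin.
  by rewrite linearP x0 y0 scaler0 addr0.
pose N := psub P0 Pl; have NE x : x \in N <-> P x by exact: psubE.
have hl : linear (fun p : smod S * smod N => smod_incl S p.1 + smod_incl N p.2).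
  move=> c [a1 b1] [a2 b2].
  have -> : (c *: (a1, b1) + (a2, b2) : smod S * smod N) = (c *: a1 + a2, c *: b1 + b2) by [].
  by rewrite !linearP scalerDr addrACA.
exists (smod N); apply: iso_sym; apply: (iso_range (h := mklin hl)) => [[a b]|x].
  rewrite /mklin /= /mklin_fun /= => ab0; have [bT b0] := (NE _).1 (smod_in b).
  have a0 : val a = 0.
    by rewrite -(rS _ (smod_in a)) -[RHS](linear0 r) -ab0 linearD b0 addr0.
  move: ab0; rewrite a0 add0r => b0'.
  by congr (_, _); apply: val_inj.
split=> [xT|[[a b] <-]]; last first.
  rewrite rpredD //; first exact/ST/smod_in.
  by have [] := (NE _).1 (smod_in b).
have xN : x - r x \in N.
  apply/NE; split; first by rewrite sub_sub //; exact/ST/rT.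
  by rewrite linearB /= (rS (r x)) ?subrr //; exact: rT.
by exists (Smod (rT x xT), Smod xN); rewrite /mklin /= /mklin_fun /= addrC subrK.
Qed.

End Basics.

Section DProd.
Variables (R : pzRingType) (T : small) (M : T -> rmodType R).
Definition dprod : small := forall t, M t.
HB.instance Definition _ := Choice.on dprod.
Implicit Types f g h : dprod.
Definition dprod_add f g : dprod := fun t => f t + g t.
Definition dprod_opp f : dprod := fun t => - f t.
Definition dprod_zero : dprod := fun t => 0.
Definition dprod_scale (r : R^c) f : dprod := fun t => r *: f t.
Lemma dprodP f g : (forall t, f t = g t) -> f = g.
Proof. exact: functional_extensionality_dep. Qed.
Fact dprod_addA : associative dprod_add.
Proof. by move=> f g h; apply: dprodP => t; exact: addrA. Qed.
Fact dprod_addC : commutative dprod_add.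
Proof. by move=> f g; apply: dprodP => t; exact: addrC. Qed.
Fact dprod_add0 : left_id dprod_zero dprod_add.
Proof. by move=> f; apply: dprodP => t; exact: add0r. Qed.
Fact dprod_addN : left_inverse dprod_zero dprod_opp dprod_add.
Proof. by move=> f; apply: dprodP => t; exact: addNr. Qed.
HB.instance Definition _ := GRing.isZmodule.Build dprod
  dprod_addA dprod_addC dprod_add0 dprod_addN.
Fact dprod_scaleA a b f : dprod_scale a (dprod_scale b f) = dprod_scale (a * b) f.
Proof. by apply: dprodP => t; exact: scalerA. Qed.
Fact dprod_scale1 : left_id 1 dprod_scale.
Proof. by move=> f; apply: dprodP => t; exact: scale1r. Qed.
Fact dprod_scaleDr : right_distributive dprod_scale +%R.
Proof. by move=> a f g; apply: dprodP => t; exact: scalerDr. Qed.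
Fact dprod_scaleDl f : {morph dprod_scale^~ f : a b / a + b}.
Proof. by move=> a b; apply: dprodP => t; exact: scalerDl. Qed.
HB.instance Definition _ := GRing.Zmodule_isLmodule.Build R^c dprod
  dprod_scaleA dprod_scale1 dprod_scaleDr dprod_scaleDl.

Fact dprod_ev_linear t : linear (fun f : dprod => f t).
Proof. by []. Qed.
Definition dprod_ev t : {linear dprod -> M t} := mklin (dprod_ev_linear t).
End DProd.

(** * Well-orders and cardinals *)

Section WellOrder.
Variables (I : small) (le : rel I).
Hypothesis wo : wochoice.well_order le.
Implicit Types i j k : I.

Lemma wo_min (P : I -> Prop) i : P i ->
  exists2 m, P m & forall j, P j -> le m j.
Proof.
move=> Pi; have [|m [[mP mmin] _]] := wo (A := fun j => `[< P j >]).
  by exists i; apply/asboolP.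
by exists m => [|j Pj]; [exact/asboolP|apply: mmin; apply/asboolP].
Qed.

Lemma wo_total i j : le i j \/ le j i.
Proof.
have [m [->|->] mmin] := @wo_min (fun k => k = i \/ k = j) i (or_introl erefl).
  by left; apply: mmin; right.
by right; apply: mmin; left.
Qed.

Lemma wo_refl i : le i i.
Proof. by case: (wo_total i i). Qed.

Lemma wo_anti i j : le i j -> le j i -> i = j.
Proof.
move=> ij ji; have [|m [_ muniq]] := wo (A := fun k => `[< k = i \/ k = j >]).
  by exists i; apply/asboolP; left.
rewrite -(muniq i) 1?(muniq j) //; split=> [|k]; try (by apply/asboolP; tauto);
  by move=> /asboolP [->|->]; rewrite ?wo_refl.
Qed.

Lemma wo_trans i j k : le i j -> le j k -> le i k.
Proof.
move=> ij jk; have [m [->|[->|->]] mmin] :=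
    @wo_min (fun l => l = i \/ l = j \/ l = k) i (or_introl erefl).
- by apply: mmin; tauto.
- by rewrite (wo_anti ij (mmin i _)) //; tauto.
- by rewrite -(wo_anti jk (mmin j _)) //; tauto.
Qed.

Lemma oltW i j : olt le i j -> le i j.
Proof. by rewrite /olt; case: (wo_total i j) => ->. Qed.

Lemma leNolt i j : le i j \/ olt le j i.
Proof. by rewrite /olt; case: (le i j); [left|right]. Qed.

Lemma olt_irr i : ~ olt le i i.
Proof. by rewrite /olt wo_refl. Qed.

Lemma le_olt_trans i j k : le i j -> olt le j k -> olt le i k.
Proof. by rewrite /olt => ij; apply: contraNN => ki; exact: wo_trans ki ij. Qed.

Lemma olt_le_trans i j k : olt le i j -> le j k -> olt le i k.
Proof. by rewrite /olt => /[swap] jk; apply: contraNN => ki; exact: wo_trans jk ki. Qed.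

Lemma olt_trans i j k : olt le i j -> olt le j k -> olt le i k.
Proof. by move=> /oltW; exact: le_olt_trans. Qed.

Lemma le_eqVolt i j : le i j -> i = j \/ olt le i j.
Proof. by move=> ij; case: (leNolt j i) => [/(wo_anti ij)|]; [left|right]. Qed.

Lemma wo_ind (P : I -> Prop) :
  (forall i, (forall j, olt le j i -> P j) -> P i) -> forall i, P i.
Proof.
move=> IH i; apply: contrapT => nPi.
have [m nPm mmin] := @wo_min (fun j => ~ P j) i nPi.
apply: nPm; apply: IH => j jm; apply: contrapT => /mmin.
by apply/negP.
Qed.

Lemma zero_succ_limit i :
  [\/ is_least le i, exists j, is_succ le j i | is_limit le i].
Proof.
have [[j ji]|/forallNP n] := pselect (exists j, olt le j i); last first.
  by constructor 1 => j; case: (leNolt i j) => // /n.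
have [|/forallNP s] := pselect (exists j, is_succ le j i); first by constructor 2.
by constructor 3; split; first by exists j.
Qed.

Lemma succ_le i j k : is_succ le j i -> olt le k i -> le k j.
Proof.
move=> [_ s] ki; case: (leNolt k j) => // /s ik.
by have := olt_le_trans ki ik => /olt_irr.
Qed.

Lemma limit_next i j : is_limit le i -> olt le j i ->
  exists2 k, olt le j k & olt le k i.
Proof.
move=> [_ nsucc] ji; apply: contrapT => no; apply: (nsucc j); split=> // k jk.
by case: (leNolt i k) => // ki; case: no; exists k.
Qed.

End WellOrder.

Lemma card_leT_inj (X Y : Type) :
  [set: X] #<= [set: Y] -> exists f : X -> Y, injective f.
Proof.
move=> /card_leP /unsquash f.
pose inX (x : X) : [set: X] := SigSub (mem_set (I : [set: X] x)).
exists (fun x => set_val (f (inX x))) => x y /val_inj fxy.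
have := @inj _ _ setT f (inX x) (inX y); rewrite !inE => /(_ I I fxy).
by move=> /(congr1 set_val).
Qed.

Lemma inj_card_leT (X Y : Type) (f : X -> Y) :
  injective f -> [set: X] #<= [set: Y].
Proof.
move=> fi; have : f @` [set: X] #= [set: X].
  by apply: inj_card_eq => x y _ _; exact: fi.
rewrite card_eq_le => /andP[_ h].
exact: card_le_trans h (card_leT _).
Qed.

Lemma surj_card_leT (X Y : Type) (f : X -> Y) :
  (forall y, exists x, f x = y) -> [set: Y] #<= [set: X].
Proof.
move=> fs; have <- : f @` [set: X] = [set: Y].
  by apply/seteqP; split=> // y _; have [x <-] := fs y; exists x.
exact: card_image_le.
Qed.

(** * Filtrations *)
Section Filtrations.
Variable R : pzRingType.
Implicit Types (C D : rmodType R -> Prop) (M N : rmodType R).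

Definition upto_iso C N := exists2 N', C N' & isomorphic N N'.

Lemma upto_isoW C N N' : isomorphic N N' -> upto_iso C N' -> upto_iso C N.
Proof. by move=> NN' [N'' ? ?]; exists N'' => //; exact: iso_trans NN' _. Qed.

Lemma filtered_zero C M : (forall x : M, x = 0) -> filtered C M.
Proof.
move=> M0; pose A (_ : unit) : submodClosed M := gensub setT.
have inA i x : x \in A i by apply: gensub_gen.
exists unit, (fun _ _ => true), tt, A; split=> //.
- split=> // P [[] P1]; exists tt; split=> [|[]//]; split=> // -[].
- by move=> i j _ x _.
- by move=> i [[j]].
- by move=> i j [].
Qed.

Lemma filtered_iso C M M' : isomorphic M M' -> filtered C M -> filtered C M'.
Proof.
move=> /iso_sym [g gb] [I [le [top [A [wo mono [A0 Atop] lim succ]]]]].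
have Pl i r x y : g x \in A i -> g y \in A i -> g (r *: x + y) \in A i.
  by rewrite linearP; exact: sub_lin.
have P0 i : g 0 \in A i by rewrite linear0 rpred0.
pose A' i : submodClosed M' := psub (P0 i) (@Pl i).
have A'E i x : (x \in A' i) = (g x \in A i) by apply/psubP/idP.
exists I, le, top, A'; split=> //.
- by move=> i j ij x; rewrite !A'E; exact: mono.
- split=> [i i0 x|x]; rewrite A'E; last exact: Atop.
  split=> [/(A0 _ i0)|->].
    by rewrite -[RHS](linear0 g) => /(bij_inj gb).
  by rewrite linear0 rpred0.
- move=> i il x; rewrite A'E lim //.
  by split=> -[j ji xj]; exists j => //; move: xj; rewrite A'E.
- move=> i j ij; apply: upto_isoW (succ i j ij).
  apply: (subquot_iso (h := g)) => [x|a aA|x _]; rewrite ?A'E //.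
  have [g' _ gK] := gb; exists (g' a); first by rewrite A'E gK.
  by rewrite gK subrr rpred0.
Qed.

Section Sum.
Variables (I J : small) (leI : rel I) (leJ : rel J).
Hypotheses (woI : wochoice.well_order leI) (woJ : wochoice.well_order leJ).

Definition sum_le (a b : I + J) : bool :=
  match a, b with
  | inl i, inl i' => leI i i'
  | inl _, inr _ => true
  | inr _, inl _ => false
  | inr j, inr j' => leJ j j'
  end.

Lemma sum_wo : wochoice.well_order sum_le.
Proof.
apply: wochoice.antisymmetric_well_order => [[i|j] [i'|j'] //= /andP[ab ba]|P [x Px]].
- by rewrite (wo_anti woI ab ba).
- by rewrite (wo_anti woJ ab ba).
- have [[i Pi]|/forallNP nI] := pselect (exists i, inl i \in P).
    have [m Pm mmin] := wo_min woI (P := fun i => inl i \in P) Pi.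
    by exists (inl m); split=> // -[] //= i' /mmin.
  have [j Pj] : exists j, inr j \in P by case: x Px => [i /nI|j]; last exists j.
  have [m Pm mmin] := wo_min woJ (P := fun j => inr j \in P) Pj.
  by exists (inr m); split=> // -[i /nI|j' /mmin].
Qed.
End Sum.

(** Concatenate a filtration of A and, above A, one of B. The last step of the
    first and the first step of the second are equal, so that there is a zero
    quotient between them. *)
Lemma filtered_prod C A B :
  upto_iso C (zero_mod R) -> filtered C A -> filtered C B ->
  filtered C (A * B)%type.
Proof.
move=> C0 [I [leI [topI [F [[woI topIP] monoF [F0 Ftop] limF succF]]]]].
move=> [J [leJ [topJ [G [[woJ topJP] monoG [G0 Gtop] limG succG]]]]].
pose P (a : I + J) (p : A * B) : Prop :=
  match a with inl i => p.1 \in F i /\ p.2 = 0 | inr j => p.2 \in G j end.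
have P0 a : P a 0 by case: a => [i|j] /=; rewrite rpred0.
have Pl a r x y : P a x -> P a y -> P a (r *: x + y).
  case: a => [i|j] /=; last exact: sub_lin.
  move=> [x1 x2] [y1 y2]; split; first exact: sub_lin.
  by rewrite x2 y2 scaler0 addr0.
pose H a : submodClosed (A * B)%type := psub (P0 a) (@Pl a).
have HE a x : x \in H a <-> P a x by exact: (psubE (P0 a) (@Pl a)).
exists (I + J)%type, (sum_le leI leJ), (inr topJ), H; split.
- by split; [exact: sum_wo | case].
- move=> [i|j] [i'|j'] //= ij x /HE Px; apply/HE; move: Px => /=.
  + by move=> [/(monoF _ _ ij)].
  + by move=> [_ ->]; rewrite rpred0.
  + exact: monoG.
- split=> [|x]; last by apply/HE => /=.
  move=> [i|j] a0 x; last by have := a0 (inl topI).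
  have i0 : is_least leI i by move=> i'; exact: (a0 (inl i')).
  rewrite HE /=; split=> [[/(F0 _ i0)]|->]; last by rewrite rpred0.
  by case: x => x1 x2 /= -> ->.
- move=> [i|j] [[b ba] nsucc] x; rewrite HE /=.
    have il : is_limit leI i.
      split; first by case: b ba => // i' i'i; exists i'.
      move=> i' [i'i s]; case: (nsucc (inl i')); split=> // -[k|//]; exact: s.
    rewrite (limF _ il); split=> [[[i' i'i xi'] x2]|[[i'|j'] // i'i /HE [x1 x2]]].
      by exists (inl i') => //; apply/HE.
    by split=> //; exists i'.
  have [j0|[j' sj']|jl] := zero_succ_limit leJ j.
  + case: (nsucc (inl topI)); split=> // -[k|k _] /=; last exact: j0.
    by rewrite /olt /= topIP.
  + case: (nsucc (inr j')); split; first exact: sj'.1.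
    by move=> [//|k]; exact: sj'.2.
  + rewrite (limG _ jl); split=> [[j' j'j xj']|[[i'|j'] i'j /HE]] /=.
    * by exists (inr j') => //; apply/HE.
    * have [j'' j''j] := jl.1; move=> [_ ->]; exists j'' => //; exact: rpred0.
    * by move=> ?; exists j'.
- move=> [i|j] [i'|j'] [ab s] //=.
  + have sI : is_succ leI i i' by split=> // k; exact: (s (inl k)).
    apply: upto_isoW (succF i i' sI); apply: iso_sym.
    have hl : linear (fun x : A => (x, 0 : B) : (A * B)%type).
      move=> r x y; apply/eqP.
      by rewrite xpair_eqE eqxx /= scaler0 addr0 eqxx.
    apply: (subquot_iso (h := mklin hl)) => [x xF|[a1 a2]|x xF].
    * by apply/HE.
    * move=> /HE [/= a1F ->]; exists a1 => //.
      by rewrite subrr rpred0.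
    * by apply/idP/idP => [/HE []//|xFi]; apply/HE; split.
  + have iTop k : leI k i.
      by case: (leNolt leI k i) => // ik; have := s (inl k) ik.
    apply: upto_isoW C0; apply: iso_qmod_zero => x /HE /=.
    have j0 : is_least leJ j' by move=> k; exact: (s (inr k)).
    rewrite (G0 _ j0) => x2; apply/HE; split=> //.
    by rewrite (wo_anti woI (topIP i) (iTop topI)).
  + have sJ : is_succ leJ j j' by split=> // k; exact: (s (inr k)).
    apply: upto_isoW (succG j j' sJ).
    have hl : linear (fun p : A * B => p.2) by [].
    apply: (subquot_iso (h := mklin hl)) => [x /HE//|a aG|x _].
    * by exists (0, a); [apply/HE | rewrite subrr rpred0].
    * by apply/idP/idP; [move=> xG; apply/HE | move=> /HE].
Qed.

(** A weak form of the Hill lemma. Every nonzero x of a filtered module appears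
    first at a successor step A_(j+1), its rank; c x lists representatives
    of A_(j+1)/A_j. If H is closed under c, then each successive quotient
    A_(j+1)/A_j either is entirely represented in H or meets H trivially. The
    traces of the filtration on H and on M/H thus have the same successive
    quotients, some of them replaced by 0. *)
Lemma filtered_closed C (V : small) M :
  upto_iso C (zero_mod R) ->
  (forall N, C N -> exists s : V -> N, forall y, exists v, s v = y) ->
  filtered C M ->
  exists c : M -> V -> M, forall H : submodClosed M,
    (forall x v, x \in H -> c x v \in H) ->
    filtered C (smod H) /\ filtered C (qmod H).
Proof.
move=> C0 CV [I [le [top [A [[wo topP] mono [A0 Atop] lim succ]]]]].
have /choice [b bP] : forall i, exists b : V -> M, forall j, is_succ le j i ->
    (forall v, b v \in A i) /\
    forall a, a \in A i -> exists v, a - b v \in A j.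
  move=> i; have [[j ji]|no] := pselect (exists j, is_succ le j i); last first.
    by exists (fun=> 0) => j ji; case: no; exists j.
  have [N CN /iso_sym [f fb]] := succ _ _ ji; have [s sP] := CV N CN.
  have /choice [q qP] : forall v, exists x, qpi _ x = f (s v).
    by move=> v; exact: qpi_surj.
  exists (fun v => val (q v)) => j' j'i.
  have -> : j' = j.
    by apply: (wo_anti wo); apply: (succ_le wo); eauto; [case: j'i|case: ji].
  split=> [v|a aA]; first exact: smod_in.
  have [g fg gf] := fb; have [v sv] := sP (g (qpi _ (Smod aA))).
  by exists v; have := qP v; rewrite sv gf => /esym /qpi_eq.
have /choice [rk rkP] : forall x, exists r : I, forall j i, is_succ le j i ->
    x \in A i -> x \notin A j -> r = i.
  move=> x; pose P i := exists j, [/\ is_succ le j i, x \in A i & x \notin A j].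
  have [[i [j [ji xi xj]]]|no] := pselect (exists i, P i); last first.
    by exists top => j i ji xi xj; case: no; exists i, j.
  exists i => j' i' ji' xi' xj'.
  have aux k k' l l' : is_succ le k l -> is_succ le k' l' -> x \in A l ->
      x \notin A k' -> le l' l.
    move=> kl kl' xl; apply: contraNT => ll'.
    by apply: (mono l) => //; exact: succ_le kl' ll'.
  by apply: (wo_anti wo); [apply: aux ji' ji _ _ | apply: aux ji ji' _ _].
exists (fun x => b (rk x)) => H Hc.
(* the dichotomy: H represents all of A_i/A_j, or nothing of it *)
have dich j i : is_succ le j i ->
    (forall v, b i v \in H) \/ (forall x, x \in H -> x \in A i -> x \in A j).
  move=> ji; have [|no] := pselect (forall x, x \in H -> x \in A i -> x \in A j).
    by right.
  left=> v; have [x /not_implyP[xH /not_implyP[xi /negP xj]]] := (existsNP _).2 no.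
  by rewrite -(rkP x j i) //; exact: Hc.
split.
  exists I, le, top, (fun i => inside H (A i) : submodClosed (smod H)).
  split=> //.
  - by move=> i j ij x; rewrite !inside_in; exact: mono.
  - split=> [i i0 x|x]; rewrite inside_in; last exact: Atop.
    by split=> [/(A0 _ i0) x0|->]; [exact: val_inj|rewrite linear0 rpred0].
  - by move=> i il x; rewrite inside_in lim.
  - move=> j i ji; case: (dich j i ji) => [bH|HA]; last first.
      apply: upto_isoW C0; apply: iso_qmod_zero => x; rewrite !inside_in.
      exact/HA/smod_in.
    have [bA bs] := bP i j ji.
    apply: upto_isoW (succ j i ji).
    apply: (subquot_iso (h := smod_incl H)) => // a aA.
    have [v av] := bs a aA; exists (Smod (bH v)); first by rewrite inside_in bA.
    by rewrite -opprB sub_opp.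
pose P i q := exists2 a, a \in A i & qpi H a = q.
have P0 i : P i 0 by exists 0; rewrite ?rpred0 ?linear0.
have Pl i r x y : P i x -> P i y -> P i (r *: x + y).
  move=> [a aA <-] [b' bA <-]; exists (r *: a + b'); first exact: sub_lin.
  by rewrite linearP.
pose A' i : submodClosed (qmod H) := psub (P0 i) (@Pl i).
have A'E i x : x \in A' i <-> P i x by exact: (psubE (P0 i) (@Pl i)).
exists I, le, top, A'; split=> //.
- by move=> i j ij x /A'E [a aA <-]; apply/A'E; exists a => //; exact: mono aA.
- split=> [i i0 x|x]; last first.
    by apply/A'E; have [a <-] := qpi_surj x; exists a.
  split=> [/A'E [a /(A0 _ i0) -> <-]|->]; [exact: linear0|exact: rpred0].
- move=> i il x; split=> [/A'E [a /(lim _ il) [j ji aj] <-]|[j ji /A'E [a aj <-]]].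
    by exists j => //; apply/A'E; exists a.
  by apply/A'E; exists a => //; apply/(lim _ il); exists j.
- move=> j i ji; have ij := oltW wo ji.1.
  case: (dich j i ji) => [bH|HA].
    have [bA bs] := bP i j ji.
    apply: upto_isoW C0; apply: iso_qmod_zero => x /A'E [a aA <-].
    have [v av] := bs a aA; apply/A'E; exists (a - b i v) => //.
    by apply/qpi_eq; rewrite addrAC subrr add0r; exact/sub_opp/bH.
  apply: upto_isoW (succ j i ji); apply: iso_sym.
  apply: (subquot_iso (h := qpi H)) => [x xA|q /A'E [a aA <-]|x xA].
  + by apply/A'E; exists x.
  + by exists a; rewrite // subrr rpred0.
  + apply/idP/idP => [/A'E [a aA /qpi_eq axH]|xA']; last by apply/A'E; exists x.
    rewrite -[x](subKr a) sub_sub // HA // sub_sub //; exact: mono ij _ _.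
Qed.

End Filtrations.

(** * The three kinds of embeddings, inside one ambient module *)
Section Embeddings.
Variable R : pzRingType.
Implicit Types (U M : rmodType R) (k : embedding_kind).

(** What it takes, for a submodule A of B, that the inclusion be an embedding of
    kind k. As no submodule is regarded as a module of its own, A and B can
    vary freely; in the pure case the right-hand sides of the system are
    replaced by the values of a solution in B. *)
Definition emb_rel k U (A B : set U) : Prop :=
  match k with
  | AllEmbeddings => True
  | RDEmbeddings => forall (r : R^c) y, B y -> A (r *: y) ->
      exists2 x, A x & r *: x = r *: y
  | PureEmbeddings => forall (m n : nat) (a : 'M[R]_(m, n)) (x : 'I_n -> U),
      (forall j, B (x j)) ->
      (forall i, A (\sum_(j < n) (a i j : R^c) *: x j)) ->
      exists2 y : 'I_n -> U, forall j, A (y j) &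
        forall i, \sum_(j < n) (a i j : R^c) *: y j =
                  \sum_(j < n) (a i j : R^c) *: x j
  end.

Lemma embeddingE k M (A : submodClosed M) :
  embedding k (smod_incl A) <-> emb_rel k [set` A] setT.
Proof.
have rE : range (smod_incl A) = [set` A].
  apply/seteqP; split=> [_ [x _ <-]|x xA]; first exact: smod_in.
  by exists (Smod xA).
rewrite /embedding rE; case: k => /=; split=> //.
- by move=> _; split=> //; exact: val_inj.
- move=> [_ rd] r y _ yA.
  have : ([set` A] `&` [set (r : R^c) *: x | x in setT]) (r *: y) by split=> //; exists y.
  by rewrite rd => -[x]; exists x.
- move=> rd; split=> [|r]; first exact: val_inj.
  apply/seteqP; split=> [z [zA [y _ yE]]|_ [x xA <-]].
    have [x xA xE] : exists2 x, [set` A] x & (r : R^c) *: (x : M) = (r : R^c) *: y.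
      by apply: rd; rewrite // yE.
    by exists x => //; rewrite xE.
  by split; [exact: rpredZ|exists x].
- move=> [_ pu] m n a x _ xA.
  have [y [yA yE]] := pu m n a _ xA (ex_intro _ x (fun i => erefl)).
  by exists y.
- move=> pu; split=> [|m n a b bA [x xE]]; first exact: val_inj.
  have [//|i|y yA yE] := pu m n a x; first by rewrite /= xE; exact: bA.
  by exists y; split=> // i; rewrite yE.
Qed.

Lemma emb_rel_inside k U (A B : submodClosed U) : {subset A <= B} ->
  emb_rel k [set` inside B A] setT <-> emb_rel k [set` A] [set` B].
Proof.
move=> AB; case: k => /=; split=> //.
- move=> rd r y yB yA; have [x xA xE] := rd r (Smod yB) I yA.
  by exists (val x) => //; have := congr1 val xE.
- move=> rd r y _ yA; have [x xA xE] := rd r (val y) (smod_in y) yA.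
  by exists (Smod (AB x xA)) => //; exact: val_inj.
- move=> pu m n a x xB xA; pose x' j := Smod (xB j).
  have sE (z : 'I_n -> smod B) i : val (\sum_(j < n) (a i j : R^c) *: z j) =
      \sum_(j < n) (a i j : R^c) *: val (z j).
    by rewrite linear_sum; apply: eq_bigr => j _; rewrite linearZ.
  have [//|i|y yA yE] := pu m n a x'; first by rewrite /= inside_in sE xA.
  by exists (val \o y) => // i; rewrite -sE yE sE.
- move=> pu m n a x _ xA.
  have sE (z : 'I_n -> smod B) i : val (\sum_(j < n) (a i j : R^c) *: z j) =
      \sum_(j < n) (a i j : R^c) *: val (z j).
    by rewrite linear_sum; apply: eq_bigr => j _; rewrite linearZ.
  have [j|i|y yA yE] := pu m n a (val \o x); first exact: smod_in.
    by rewrite -sE; exact: xA.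
  exists (fun j => Smod (AB _ (yA j))) => // i.
  by apply: val_inj; rewrite !sE yE.
Qed.

Lemma emb_rel_refl k U (A : set U) : emb_rel k A A.
Proof.
case: k => [//|r y yA _|m n a x xA _] /=; first by exists y.
by exists x.
Qed.

Lemma emb_rel_trans k U (A B C : set U) : A `<=` B ->
  emb_rel k A B -> emb_rel k B C -> emb_rel k A C.
Proof.
case: k => //= AB ABe BCe => [r y yC yA|m n a x xC xA].
  have [x xB xE] := BCe r y yC (AB _ yA).
  have [|z zA zE] := ABe r x xB; first by rewrite xE.
  by exists z; rewrite // zE.
have [i|y yB yE] := BCe m n a x xC; first exact/AB/xA.
have [i|z zA zE] := ABe m n a y yB; first by rewrite yE.
by exists z => // i; rewrite zE.
Qed.

Lemma emb_rel_sub k U (A B C : set U) : B `<=` C ->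
  emb_rel k A C -> emb_rel k A B.
Proof.
case: k => //= BC ACe => [r y yB|m n a x xB].
  by apply: ACe; exact: BC.
by apply: ACe => j; exact: BC.
Qed.

(** All three notions are of finite character: only finitely many elements
    of A and of B are involved at a time. *)
Lemma emb_rel_local k U (A B : set U) :
  (forall s t : seq U, (forall x, x \in s -> A x) -> (forall x, x \in t -> B x) ->
    exists A' B' : set U, [/\ A' `<=` A, forall x, x \in s -> A' x,
      forall x, x \in t -> B' x & emb_rel k A' B']) ->
  emb_rel k A B.
Proof.
case: k => //= loc => [r y yB yA|m n a x xB xA].
  have [||A' [B' [A'A sA' tB' e]]] := loc [:: r *: y] [:: y].
  - by move=> z; rewrite inE => /eqP ->.
  - by move=> z; rewrite inE => /eqP ->.
  have [||z zA' zE] := e r y; [by apply: tB'; rewrite inE|by apply: sA'; rewrite inE|].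
  by exists z => //; exact: A'A.
have [||A' [B' [A'A sA' tB' e]]] :=
  loc [seq \sum_(j < n) (a i j : R^c) *: x j | i : 'I_m] [seq x j | j : 'I_n].
- by move=> z /mapP [i _ ->].
- by move=> z /mapP [i _ ->].
have [j|i|z zA' zE] := e m n a x.
- by apply: tB'; apply: map_f; rewrite mem_enum.
- by apply: sA'; apply: (map_f (fun i => \sum_(j < n) (a i j : R^c) *: x j)); rewrite mem_enum.
by exists z => // j; exact: A'A.
Qed.

(** Only finitely many elements of A matter at a time, so that the retraction
    of B into A may depend on those that it has to fix. *)
Lemma emb_rel_split k U (A B : set U) :
  (forall s : seq U, (forall x, x \in s -> A x) ->
    exists r : {linear U -> U}, (forall x, B x -> A (r x)) /\
      forall x, x \in s -> r x = x) ->
  emb_rel k A B.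
Proof.
case: k => //= spl => [r y yB yA|m n a x xB xA].
  have [|f [fBA fid]] := spl [:: r *: y]; first by move=> z; rewrite inE => /eqP ->.
  exists (f y); first exact: fBA.
  by rewrite -linearZ fid // inE.
have [|f [fBA fid]] := spl [seq \sum_(j < n) (a i j : R^c) *: x j | i : 'I_m].
  by move=> z /mapP [i _ ->].
exists (f \o x) => [j|i]; first exact/fBA/xB.
rewrite -[RHS]fid; last first.
  by apply: (map_f (fun i => \sum_(j < n) (a i j : R^c) *: x j)); rewrite mem_enum.
by rewrite linear_sum; apply: eq_bigr => j _; rewrite linearZ.
Qed.

Lemma emb_rel_iso k U U' (f : {linear U -> U'}) (A : set U) (A' : set U') :
  bijective f -> (forall x, A' (f x) <-> A x) ->
  emb_rel k A setT -> emb_rel k A' setT.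
Proof.
move=> [g fK gK] AA'; case: k => //= [rd r y _ yA|pu m n a x _ xA].
  have [//||x xA xE] := rd r (g y); first by apply/AA'; rewrite linearZ gK.
  by exists (f x); [exact/AA'|rewrite -linearZ xE linearZ gK].
have sE (z : 'I_n -> U) i : f (\sum_(j < n) (a i j : R^c) *: z j) =
    \sum_(j < n) (a i j : R^c) *: f (z j).
  by rewrite linear_sum; apply: eq_bigr => j _; rewrite linearZ.
have xE i : \sum_(j < n) (a i j : R^c) *: x j = f (\sum_(j < n) (a i j : R^c) *: g (x j)).
  by rewrite sE; apply: eq_bigr => j _; rewrite gK.
have [//|i|y yA yE] := pu m n a (g \o x); first by apply/AA'; rewrite -xE; exact: xA.
by exists (f \o y) => [j|i]; [exact/AA'|rewrite -sE yE -xE].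
Qed.

Lemma chain_seq U (I : small) (le : rel I) (A : I -> set U) (s : seq U) i0 :
  (forall i j, le i j \/ le j i) -> (forall i j, le i j -> A i `<=` A j) ->
  (forall x, x \in s -> exists i, A i x) ->
  exists i, A i0 `<=` A i /\ forall x, x \in s -> A i x.
Proof.
move=> tot mono; elim: s => [|x s IH] sA; first by exists i0; split.
have [|i [i0i si]] := IH; first by move=> y ys; apply: sA; rewrite inE ys orbT.
have [j xj] := sA x (mem_head _ _).
have [/mono ij|/mono ji] := tot i j.
  exists j; split=> [y /i0i|y]; first exact: ij.
  by rewrite inE => /orP[/eqP->//|/si]; exact: ij.
exists i; split=> // y; rewrite inE => /orP[/eqP->|/si//]; exact: ji.
Qed.

Lemma chain_emb_union k U (I : small) (le : rel I) (A : I -> set U) (V : set U) i0 :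
  (forall i j, le i j \/ le j i) -> (forall i j, le i j -> A i `<=` A j) ->
  (forall i j, le i j -> emb_rel k (A i) (A j)) ->
  (forall x, V x <-> exists i, A i x) -> emb_rel k (A i0) V.
Proof.
move=> tot mono emb VE; apply: emb_rel_local => s t sA tV.
have [|i [i0i ti]] := chain_seq (s := t) i0 tot mono; first by move=> x xt; apply/VE/tV.
exists (A i0), (A i); split=> //.
have [/emb //|ii0] := tot i0 i.
by apply: emb_rel_sub (emb_rel_refl k (A i0)); exact: mono.
Qed.

Lemma union_emb k U (I : small) (le : rel I) (A : I -> set U) (V B : set U) (i0 : I) :
  (forall i j, le i j \/ le j i) -> (forall i j, le i j -> A i `<=` A j) ->
  (forall i, emb_rel k (A i) B) ->
  (forall x, V x <-> exists i, A i x) -> emb_rel k V B.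
Proof.
move=> tot mono emb VE; apply: emb_rel_local => s t sV tB.
have [|i [i0i si]] := chain_seq (s := s) i0 tot mono; first by move=> x xs; apply/VE/sV.
by exists (A i), B; split=> // x Ax; apply/VE; exists i.
Qed.

End Embeddings.

(** * Transfinite extensions by steps *)

Section GensubChain.
Variables (R : pzRingType) (U : rmodType R).

Lemma gensub_chain (I : small) (le : rel I) (P : I -> Prop)
    (A : I -> submodClosed U) (Y : set U) i0 :
  (forall i j, le i j \/ le j i) ->
  (forall i j, le i j -> {subset A i <= A j}) -> P i0 ->
  (forall y, Y y -> exists2 i, P i & y \in A i) ->
  forall x, x \in gensub Y -> exists2 i, P i & x \in A i.
Proof.
move=> tot mono Pi0 YA; apply: gensub_ind => //.
  by exists i0; rewrite ?rpred0.
move=> r x y [i Pi xi] [j Pj yj]; have [/mono ij|/mono ji] := tot i j.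
  by exists j => //; apply: sub_lin => //; exact: ij.
by exists i => //; apply: sub_lin => //; exact: ji.
Qed.

End GensubChain.

Lemma sub_type_wo (T : small) (le : rel T) (q : set T) :
  wochoice.well_order le ->
  wochoice.well_order (fun a b : {t | q t} => le (sval a) (sval b)).
Proof.
move=> wo; apply: wochoice.antisymmetric_well_order => [[a qa] [b qb]|P [[t qt] Pt]].
  by move=> /andP[ab ba]; apply: eq_exist; exact: wo_anti wo _ _ ab ba.
have [m [qm Pm] mmin] :=
  wo_min wo (P := fun t => exists h : q t, exist _ t h \in P) (ex_intro _ qt Pt).
exists (exist _ m qm); split=> // -[s qs] Ps; apply: mmin.
by exists qs.
Qed.

(** By finite character. If p is empty, then the generated submodule is 0, which
    is a direct summand of any module. *)
Lemma gensub_emb (R : pzRingType) (k : embedding_kind) (U : rmodType R)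
    (T : small) (le : rel T) (p : set T)
    (A : T -> submodClosed U) (Y : set U) (B : submodClosed U) :
  wochoice.well_order le ->
  (forall i j, p i -> p j -> le i j -> {subset A i <= A j}) ->
  (forall y, Y y -> exists2 i, p i & y \in A i) ->
  (forall i, p i -> {subset A i <= gensub Y}) ->
  (forall i, p i -> emb_rel k [set` A i] [set` B]) ->
  emb_rel k [set` gensub Y] [set` B].
Proof.
move=> wo mono YA AY AB; have [[i0 pi0]|p0] := pselect (exists i, p i); last first.
  have Y0 x : x \in gensub Y -> x = 0.
    apply: (gensub_ind (P := fun x => x = 0)) => // [r y z -> ->|y /YA [i pi]].
      by rewrite scaler0 addr0.
    by case: p0; exists i.
  apply: emb_rel_split => s sY; have zl : linear (fun _ : U => 0 : U).
    by move=> r x y; rewrite scaler0 addr0.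
  exists (mklin zl); split=> [x _|x /sY /Y0 ->//]; exact: rpred0.
pose I := {i | p i}; pose leI (a b : I) := le (sval a) (sval b).
have woI : wochoice.well_order leI by exact: sub_type_wo.
have monoI a b : leI a b -> {subset A (sval a) <= A (sval b)}.
  by apply: mono; [exact: (svalP a)|exact: (svalP b)].
apply: (union_emb (le := leI) (A := fun a => [set` A (sval a)]) (exist _ i0 pi0 : I)).
- exact: wo_total.
- exact: monoI.
- by move=> a; apply: AB; exact: (svalP a).
- move=> x; split=> [xY|[a]]; last by apply: AY; exact: (svalP a).
  have [y /YA [i pi yi]|a _ xa] := gensub_chain (P := fun=> True)
    (A := fun a : I => A (sval a)) (i0 := exist _ i0 pi0) (wo_total woI) monoI
    Logic.I _ xY; last by exists a.
  by exists (exist _ i pi).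
Qed.

Section ChainClosed.
Variables (R : pzRingType) (D : rmodType R -> Prop) (k : embedding_kind).
Hypothesis D_iso : forall A B, isomorphic A B -> D A -> D B.

Lemma iso_inside (U : rmodType R) (A B : submodClosed U) :
  {subset A <= B} -> isomorphic (smod (inside B A)) (smod A).
Proof.
move=> AB; apply: (iso_range (h := smod_incl B \o smod_incl (inside B A))) => [a|x].
  by move=> a0; do 2!apply: val_inj; exact: a0.
split=> [xA|[a <-]]; last exact: (smod_in a).
have xBA : Smod (AB x xA) \in inside B A by [].
by exists (Smod xBA).
Qed.

Lemma strong_inE (U : rmodType R) (A B : submodClosed U) :
  strong_in (le_emb D k) A B <->
  [/\ {subset A <= B}, D (smod A), D (smod B) & emb_rel k [set` A] [set` B]].
Proof.
split=> [[AB [DA DB /embeddingE/(emb_rel_inside k AB) e]]|[AB DA DB e]].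
  by split=> //; exact: D_iso (iso_inside AB) DA.
split=> //; split=> //; first exact: D_iso (iso_sym (iso_inside AB)) DA.
exact/embeddingE/(emb_rel_inside k AB).
Qed.

(** Among the Tarski-Vaught axioms for le_emb, this one carries the information
    on D: the other two then hold for every kind of embeddings, by finite
    character. *)
Definition chain_closed := forall (U : rmodType R) (I : small) (le : rel I)
    (A : I -> submodClosed U) (V : submodClosed U),
  wochoice.well_order le -> (forall i, D (smod (A i))) ->
  (forall i j, le i j -> {subset A i <= A j}) ->
  (forall i j, le i j -> emb_rel k [set` A i] [set` A j]) ->
  (forall i, is_limit le i -> forall x, x \in A i -> exists2 j, olt le j i & x \in A j) ->
  is_union A V -> D (smod V).

Lemma tarski_vaught_chain_closed :
  tarski_vaught D (le_emb D k) -> chain_closed.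
Proof.
move=> tv U I le A V wo DA mono emb cont AV.
have [] // := tv U I le A V _ AV; split=> // [i j ij|i il x].
  by apply/strong_inE; split=> //; [exact: mono|exact: emb].
split; first exact: cont.
by move=> [j /(oltW wo)/mono]; exact.
Qed.

Section Build.
Hypothesis closed : chain_closed.
Variables (U : rmodType R) (T : small) (le : rel T).
Hypothesis wo : wochoice.well_order le.
Variables (B0 : set U) (G : T -> set U).

Definition layer (q : set T) : submodClosed U :=
  gensub (B0 `|` \bigcup_(t in q) G t).

Lemma layer_mono (q q' : set T) : q `<=` q' -> {subset layer q <= layer q'}.
Proof.
move=> qq'; apply: gensub_mono => y [By|[t qt Gy]]; first by left.
by right; exists t => //; exact: qq'.
Qed.

Definition down (q : set T) := forall s t, le s t -> q t -> q s.

Lemma down_lt t : down [set s | olt le s t].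
Proof. by move=> r s rs; exact: le_olt_trans. Qed.

Let good (q : set T) := D (smod (layer q)) /\
  forall q', down q' -> q' `<=` q -> emb_rel k [set` layer q'] [set` layer q].

Variable p : set T.
Hypotheses (pdown : down p) (D0 : D (smod (layer set0))).
Hypothesis step : forall t, p t -> D (smod (layer [set s | olt le s t])) ->
  D (smod (layer [set s | le s t])) /\
  emb_rel k [set` layer [set s | olt le s t]] [set` layer [set s | le s t]].

(** If q has a largest element m, then q consists of m and of what precedes it,
    and the step at m applies. Otherwise layer q is the union of the chain of
    the layers of the [set s | s < t], t in q. This chain is continuous by
    construction, whatever the G t are, as chain_closed demands. *)
Lemma good_initial (q : set T) : down q -> q `<=` p ->
  (forall t, q t -> good [set s | olt le s t]) -> good q.
Proof.
move=> dq qp IH.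
have eqlt q' : down q' -> q' `<=` q -> q' = q \/ exists2 t, q t & q' `<=` [set s | olt le s t].
  move=> dq' q'q; have [|/existsNP [t /not_implyP [qt q't]]] := pselect (q `<=` q').
    by left; apply/seteqP.
  right; exists t => // s q's; case: (leNolt le t s) => // ts.
  by case: q't; exact: dq' ts q's.
have [[t0 qt0]|q0] := pselect (exists t, q t); last first.
  have -> : q = set0 by apply/seteqP; split=> // t qt; case: q0; exists t.
  by split=> // q' _ q'0; rewrite (_ : q' = set0); [exact: emb_rel_refl|apply/seteqP; split].
have [[m qm mmax]|nomax] := pselect (exists2 m, q m & forall t, q t -> le t m).
  have qE : q = [set s | le s m].
    by apply/seteqP; split=> [t /mmax|t tm]; last exact: dq tm qm.
  have [Dlt emb] := IH m qm; have [Dle emb1] := step (qp _ qm) Dlt.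
  rewrite {1}/good qE; split=> // q' dq' q'q.
  have q'q2 : q' `<=` q by rewrite qE.
  have [q'E|[t qt q'lt]] := eqlt q' dq' q'q2.
  - by rewrite q'E qE; exact: emb_rel_refl.
  - have lt' : q' `<=` [set s | olt le s m].
      by move=> s /q'lt st; apply: olt_le_trans wo _ _ _ st _; exact: mmax.
    apply: emb_rel_trans emb1; last exact: emb.
    exact: layer_mono.
have next t : q t -> exists2 t', q t' & olt le t t'.
  move=> qt; apply: contrapT => no; apply: nomax; exists t => // s qs.
  by case: (leNolt le s t) => // ts; case: no; exists s.
pose I := {t | q t}; pose leI (a b : I) := le (sval a) (sval b).
pose A (a : I) := layer [set s | olt le s (sval a)].
have woI : wochoice.well_order leI by exact: sub_type_wo.
have Amono a b : leI a b -> {subset A a <= A b}.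
  by move=> ab; apply: layer_mono => s sa; exact: olt_le_trans wo _ _ _ sa ab.
have Aemb a b : leI a b -> emb_rel k [set` A a] [set` A b].
  case: a b => [a qa] [b qb] ab; apply: (IH b qb).2; first exact: down_lt.
  by move=> s sa; exact: olt_le_trans wo _ _ _ sa ab.
have Asub a : {subset A a <= layer q}.
  by apply: layer_mono => s sa; apply: (dq _ _ (oltW wo sa)); exact: (svalP a).
have AV : is_union A (layer q).
  move=> x; split=> [|[a]]; last exact: Asub.
  move=> xq; have [|a _ xa] := gensub_chain (P := fun=> True) (A := A)
    (i0 := exist _ t0 qt0) (wo_total woI) Amono Logic.I _ xq; last by exists a.
  move=> y [By|[t qt Gy]].
    by exists (exist _ t0 qt0) => //; apply: gensub_gen; left.
  have [t' qt' tt'] := next t qt; exists (exist _ t' qt') => //.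
  by apply: gensub_gen; right; exists t.
have embA a : emb_rel k [set` A a] [set` layer q].
  apply: (chain_emb_union (le := leI) (A := fun a => [set` A a]) a) => //.
  exact: wo_total.
split.
  apply: (closed woI _ Amono Aemb _ AV) => [[a qa]|[i qi] il x xi].
    exact: (IH a qa).1.
  have [[j ji] nsucc] := il.
  apply: (gensub_chain (wo_total woI) Amono ji _ xi) => y [By|[t ti Gy]].
    by exists j => //; apply: gensub_gen; left.
  have qt : q t by apply: (dq _ _ (oltW wo ti)).
  have [[t' qt'] tt' t'i] := limit_next (le := leI) il (j := exist _ t qt) ti.
  by exists (exist _ t' qt') => //; apply: gensub_gen; right; exists t.
move=> q' dq' q'q; have [->|[t qt q'lt]] := eqlt q' dq' q'q; first exact: emb_rel_refl.
apply: emb_rel_trans (embA (exist _ t qt)); first by apply: layer_mono.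
exact: (IH t qt).2.
Qed.

(** The transfinite extension starts from layer set0; what has to be checked is
    one step, from the generators of index < t to those of index <= t. *)
Lemma build : D (smod (layer p)) /\ emb_rel k [set` layer set0] [set` layer p].
Proof.
have Hp : good p.
  apply: good_initial => // t pt; move: pt; elim/(wo_ind wo): t => t IH pt.
  apply: good_initial => [|s st|s st]; first exact: down_lt.
    exact: pdown (oltW wo st) pt.
  by apply: IH => //; exact: pdown (oltW wo st) pt.
by split; [exact: Hp.1|apply: Hp.2 => // s t].
Qed.
End Build.
End ChainClosed.

(** * Terms, and a product larger than the set of its initial parts *)
Section Terms.
Variables (A L : Type) (B : eqType) (b0 : B) (arg : A -> B) (op : L -> seq B -> B).
Definition term := GenTree.tree (A + L).

(** The first child of an internal vertex is a leaf that names an operation,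
    to be applied to the values of the other children; trees that are labelled
    at the leaves only are then enough. Ill-formed terms have the value b0. *)
Fixpoint eval (t : term) : B :=
  match t with
  | GenTree.Leaf (inl a) => arg a
  | GenTree.Node _ (GenTree.Leaf (inr l) :: ts) => op l (map eval ts)
  | _ => b0
  end.

Definition app (l : L) (ts : seq term) : term :=
  GenTree.Node 0 (GenTree.Leaf (inr l) :: ts).

Lemma eval_seq (s : seq B) : (forall b, b \in s -> exists t, eval t = b) ->
  exists ts, map eval ts = s.
Proof.
elim: s => [|b s IH] sE; first by exists [::].
have [|ts <-] := IH; first by move=> c cs; apply: sE; rewrite inE cs orbT.
by have [t <-] := sE b (mem_head _ _); exists (t :: ts).
Qed.

Lemma eval_ind (P : B -> Prop) : P b0 -> (forall a, P (arg a)) ->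
  (forall l s, (forall b, b \in s -> P b) -> P (op l s)) -> forall t, P (eval t).
Proof.
move=> P0 Parg Pop; elim=> [[a|l]|n [|[[a|l]|m us] ts]] //= [_ tsP].
apply: Pop => b; elim: ts tsP => //= t ts IH [Pt Pts].
by rewrite inE => /orP [/eqP -> //|]; exact: IH.
Qed.
End Terms.

Section Koenig.
Variables (K : small) (le : rel K).
Hypothesis wo : wochoice.well_order le.

(** This is the diagonal argument behind König's inequality. The initial parts
    below i of the elements of the product of the Y j form N i; as Y i is the
    power set of W (N i), no map from W (N i) to Y i is surjective. Choosing
    at each i a value that is missed yields an element of the product that
    differs from all those that the W (N i) enumerate together. *)
Lemma koenig_family (W : small -> small) : exists Y : K -> small,
  forall i, inhabited (Y i) /\
    forall h : W (forall j, olt le j i -> Y j) -> Y i, exists y, forall w, h w <> y.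
Proof.
have wf : well_founded (fun i j => olt le i j).
  by move=> i; elim/(wo_ind wo): i => i IH; constructor.
pose body i (rec : forall j, olt le j i -> small) : small := W (forall j h, rec j h) -> Prop.
pose Y := Fix wf (fun _ => small) body; exists Y => i.
have -> : Y i = body i (fun j _ => Y j).
  rewrite /Y Fix_eq // => l f g fg; congr body.
  by do 2 apply: functional_extensionality_dep => ?; exact: fg.
split; first by constructor => _; exact: True.
move=> h; exists (fun w => ~ h w w) => w /(congr1 (@^~ w)) hE.
have nh : ~ h w w by move=> hw; have := hw; rewrite {1}hE.
by apply: (nh); rewrite hE.
Qed.
End Koenig.

(** * Tree modules *)
Section Tree.
Variables (R : pzRingType) (D : rmodType R -> Prop) (k : embedding_kind).
Hypothesis D_iso : forall A B, isomorphic A B -> D A -> D B.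
Hypothesis D_zero : D (zero_mod R).
Hypothesis D_prod : forall A B : rmodType R, D A -> D B -> D (A * B)%type.
Hypothesis D_summand : closed_direct_summands D.
Hypothesis closed : chain_closed D k.

Variables (K : small) (le : rel K) (top : K).
Hypotheses (wo : wochoice.well_order le) (top_limit : is_limit le top).
Variables (M : K -> rmodType R) (F : forall i j, {linear M i -> M j}).
Hypothesis F_id : forall i x, F i i x = x.
Hypothesis F_comp : forall i j l x, le i j -> le j l -> F j l (F i j x) = F i l x.
Hypothesis D_M : forall i, olt le i top -> D (M i).
Variable Y : K -> small.

(** A node of level i is the restriction of a branch to the indices < i. It is
    given by a branch and i, and all that follows only depends on the
    restriction; two branches stand for the same node if they agree below i.
    An element of tree_mod is a family with one component in M i for each
    node of level i (one for each way to write the node, in fact). *)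
Definition branch : small := forall i, Y i.
Definition node : small := (branch * K)%type.
Definition agree (i : K) (a b : branch) := forall j, olt le j i -> a j = b j.
Definition tree_mod : rmodType R := dprod (fun q : K * branch => M q.1).

(** The support of a thread: the nodes along a whose levels are in [i, x[, or
    in [i, top] if x = top. Thanks to this exception, the component at
    (top, a) of a thread that never ends is its class in the colimit M top. *)
Definition below (i x : K) (a : branch) (q : K * branch) : Prop :=
  [/\ le i q.1, olt le q.1 x \/ (x = top /\ q.1 = top) & agree q.1 q.2 a].

Definition thread_fun (a : branch) (x i : K) (m : M i) : tree_mod :=
  fun q => if pselect (below i x a q) then F i q.1 m else 0.

Fact thread_linear a x i : linear (@thread_fun a x i).
Proof.
move=> r m m'; apply: dprodP => q; rewrite /thread_fun.
have -> (f g : tree_mod) : (r *: f + g) q = r *: f q + g q by [].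
by case: pselect => ? /=; rewrite ?linearP// scaler0 addr0.
Qed.

Definition thread a x i : {linear M i -> tree_mod} := mklin (@thread_linear a x i).

Lemma threadT a x i m q : below i x a q -> thread a x i m q = F i q.1 m.
Proof. by rewrite /thread /= /mklin_fun /thread_fun; case: pselect. Qed.

Lemma threadF a x i m q : ~ below i x a q -> thread a x i m q = 0.
Proof. by rewrite /thread /= /mklin_fun /thread_fun; case: pselect. Qed.

Definition gens (S : set node) : set tree_mod :=
  [set u | exists a x i (m : M i),
    [/\ S (a, x), le x top, olt le i x & u = thread a x i m]].

Definition threads (S : set node) : submodClosed tree_mod := gensub (gens S).

Lemma gens_thread (S : set node) a x i (m : M i) :
  S (a, x) -> le x top -> olt le i x -> thread a x i m \in threads S.
Proof. by move=> Sa xt ix; apply: gensub_gen; exists a, x, i, m. Qed.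

Lemma threads_mono (S S' : set node) : S `<=` S' -> {subset threads S <= threads S'}.
Proof.
move=> SS'; apply: gensub_mono => u [a [x [i [m [Sa xt ix ->]]]]].
by exists a, x, i, m; split=> //; exact: SS'.
Qed.

Lemma agree_sym i a b : agree i a b -> agree i b a.
Proof. by move=> ab j ji; rewrite ab. Qed.

Lemma agree_trans i a b c : agree i a b -> agree i b c -> agree i a c.
Proof. by move=> ab bc j ji; rewrite ab // bc. Qed.

Lemma agree_le i j a b : le i j -> agree j a b -> agree i a b.
Proof. by move=> ij ab l li; apply: ab; exact: olt_le_trans wo _ _ _ li ij. Qed.

(** A thread that stops at y is a difference of two threads that end together.
    These differences are the relations that define the colimit. *)
Lemma thread_cut a x y i (m : M i) : olt le i y -> olt le y x -> le x top ->
  thread a x i m = thread a y i m + thread a x y (F i y m).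
Proof.
move=> iy yx xt; apply: dprodP => q.
have -> (f g : tree_mod) : (f + g) q = f q + g q by [].
have ytop : y <> top.
  by move=> yE; move: yx; rewrite yE => /(fun h => olt_le_trans wo h xt) /(olt_irr wo).
have [yq|qy] := leNolt le y q.1; last first.
  rewrite (@threadF a x y _ q); last first.
    by move=> [yq _ _]; have := le_olt_trans wo yq qy => /(olt_irr wo).
  rewrite addr0; have [b|nb] := pselect (below i x a q).
    by rewrite !threadT //; case: b => ? _ ?; split=> //; left.
  rewrite !threadF // => -[iq _ ag]; apply: nb; split=> //; left.
  exact: olt_trans wo _ _ _ qy yx.
rewrite (@threadF a y i _ q); last first.
  by move=> [_ [qy|[/ytop//]]]; have := le_olt_trans wo yq qy => /(olt_irr wo).
rewrite add0r; have [b|nb] := pselect (below i x a q).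
  rewrite !threadT //; last by case: b.
  by rewrite F_comp //; exact: oltW wo _ _ iy.
rewrite !threadF // => -[_ c ag]; apply: nb; split=> //.
exact: wo_trans wo _ _ _ (oltW wo iy) yq.
Qed.

(** For x = top this uses that top is a limit: branches that agree below every
    index < top agree below top. *)
Lemma thread_agree a b x i (m : M i) : le x top ->
  (forall j, olt le j x -> agree j a b) -> thread a x i m = thread b x i m.
Proof.
move=> xt ab; apply: dprodP => q.
have agE c c' : (forall j, olt le j x -> agree j c c') -> below i x c q -> below i x c' q.
  move=> cc' [iq qx ag]; split=> //; apply: (agree_trans ag).
  case: qx => [/cc' //|[xE qE] j]; rewrite qE => jt.
  have [l jl lt] := limit_next top_limit jt.
  by apply: (cc' l) => //; rewrite xE.
have [bl|nb] := pselect (below i x a q).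
  by rewrite !threadT //; exact: agE bl.
rewrite !threadF // => /agE h; apply: nb; apply: h => j /ab; exact: agree_sym.
Qed.

(** The node t lies strictly above the node (n, i). *)
Definition passes (n : branch) (i : K) (t : node) := olt le i t.2 /\ agree i t.1 n.

(** Forgetting the components at the nodes above (n, i) turns a thread that
    passes through (n, i) into a thread that stops there; so it retracts a tree
    onto what remains when its branches are cut at (n, i). *)
Definition trunc_fun (n : branch) (i : K) (u : tree_mod) : tree_mod :=
  fun q => if pselect (le i q.1 /\ agree i q.2 n) then 0 else u q.

Fact trunc_linear n i : linear (trunc_fun n i).
Proof.
move=> r u v; apply: dprodP => q; rewrite /trunc_fun.
have e (f g : tree_mod) : (r *: f + g) q = r *: f q + g q by [].
by rewrite !e /=; case: pselect => ? //=; rewrite scaler0 addr0.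
Qed.

Definition trunc n i : {linear tree_mod -> tree_mod} := mklin (trunc_linear n i).

Lemma truncT n i u q : le i q.1 -> agree i q.2 n -> trunc n i u q = 0.
Proof. by move=> ? ?; rewrite /trunc /= /mklin_fun /trunc_fun; case: pselect => // -[]. Qed.

Lemma truncF n i u q : ~ (le i q.1 /\ agree i q.2 n) -> trunc n i u q = u q.
Proof. by move=> ?; rewrite /trunc /= /mklin_fun /trunc_fun; case: pselect. Qed.

Lemma trunc_nopass n i a x j (m : M j) : olt le i top -> ~ passes n i (a, x) ->
  trunc n i (thread a x j m) = thread a x j m.
Proof.
move=> it np; apply: dprodP => q.
have [[iq ag]|/truncF -> //] := pselect (le i q.1 /\ agree i q.2 n).
rewrite truncT // threadF // => -[jq qx aga]; apply: np; split=> /=.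
  case: qx => [|[xE _]]; last by rewrite xE.
  exact: le_olt_trans wo _ _ _ iq.
by apply: agree_trans ag; apply: agree_sym; exact: agree_le iq aga.
Qed.

Lemma trunc_pass n i a x j (m : M j) : olt le i top -> passes n i (a, x) ->
  le x top ->
  trunc n i (thread a x j m) = if olt le j i then thread a i j m else 0.
Proof.
move=> it [/= ix agi] xt; have itop : i <> top.
  by move=> iE; move: it; rewrite iE => /(olt_irr wo).
have noti q : le i q.1 -> ~ below j i a q.
  move=> iq [_ [qi _|[//]]].
  by have := le_olt_trans wo iq qi => /(olt_irr wo).
apply: dprodP => q.
have zE : (0 : tree_mod) q = 0 by [].
have [[iq ag]|ntr] := pselect (le i q.1 /\ agree i q.2 n).
  by rewrite truncT //; case: ifP => // _; rewrite threadF //; exact: noti.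
rewrite truncF //; have [iq|qi] := leNolt le i q.1.
  have nb : ~ below j x a q.
    move=> [_ _ aga]; apply: ntr; split=> //.
    exact: agree_trans (agree_le iq aga) agi.
  by rewrite threadF //; case: ifP => // _; rewrite threadF //; exact: noti.
case: ifP => ji; last first.
  rewrite zE threadF // => -[jq _ _]; move: ji.
  by rewrite (le_olt_trans wo jq qi).
have [[jq _ ag]|nb] := pselect (below j i a q).
  rewrite !threadT //; split=> //; left => //.
  exact: olt_trans wo _ _ _ qi ix.
by rewrite !threadF // => -[jq _ ag]; apply: nb; split=> //; left.
Qed.

(** ** Adding one node to a tree *)

(** Let S contain all the proper restrictions (n, i) of the node (n, x). Unless
    S already reaches as high along n, the module of S' is the union, over
    i < x, of the slices: slice i is the direct sum of the threads of the part
    of S not above (n, i) and of the threads along n that start at level i,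
    a copy of M i. The first summand is a direct summand of threads S, so that
    slice i belongs to D. Moreover, slice i is a direct summand of all that lies
    above it: this holds although the maps of the system need not be
    injective, since the kernel of F i j shows up as threads that stop. Hence
    the union belongs to D. *)
Section AddNode.
Variables (S : set node) (n : branch) (x : K).
Hypotheses (x_top : le x top)
  (S_down : forall a y z, S (a, y) -> olt le z y -> S (a, z))
  (S_below : forall y, olt le y x -> S (n, y)) (D_S : D (smod (threads S))).

Let S' : set node := S `|` [set (n, x)].
Let cut i : set node := [set t | S t /\ ~ passes n i t].

Let below_top i : olt le i x -> olt le i top.
Proof. by move=> ix; exact: olt_le_trans wo _ _ _ ix x_top. Qed.

Let trunc_cut i u : olt le i x -> u \in threads S' -> trunc n i u \in threads (cut i).
Proof.
move=> ix; apply: gensub_linear => v [a [y [j [m [Sa yt jy ->]]]]].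
have it := below_top ix.
have cut_thread : passes n i (a, y) -> S (a, i) ->
    trunc n i (thread a y j m) \in threads (cut i).
  move=> pa Sai; rewrite trunc_pass //; case: ifP => [ji|_]; last exact: rpred0.
  apply: gens_thread => //; last exact: oltW wo _ _ it.
  by split=> // -[/(olt_irr wo)].
have [pa|np] := pselect (passes n i (a, y)).
  apply: cut_thread => //; case: Sa => [/S_down|[aE yE]]; first by apply; exact: pa.1.
  by rewrite aE; apply: S_below.
rewrite trunc_nopass //; apply: gens_thread => //; split=> //.
by case: Sa => // -[aE yE]; case: np; rewrite aE yE; split.
Qed.

Let trunc_id i u : olt le i x -> u \in threads (cut i) -> trunc n i u = u.
Proof.
move=> ix; apply: (gensub_ind (P := fun u => trunc n i u = u)).
- exact: linear0.
- by move=> r v w vE wE; rewrite linearP vE wE.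
- move=> v [a [y [j [m [[Sa np] yt jy ->]]]]]; apply: trunc_nopass => //.
  exact: below_top.
Qed.

Let cut_vanish i u : olt le i x -> u \in threads (cut i) -> u (i, n) = 0.
Proof.
by move=> ix /(trunc_id ix) <-; apply: truncT => //=; exact: wo_refl wo i.
Qed.

Let D_cut i : olt le i x -> D (smod (threads (cut i))).
Proof.
move=> ix; have [|u uS|u uS|B BP] := @retract_summand _ _ (threads (cut i)) (threads S) (trunc n i).
- by apply: threads_mono => t [].
- by apply: trunc_cut => //; apply: threads_mono uS => t; left.
- exact: trunc_id.
- exact: D_summand BP D_S.
Qed.

Let slice i : submodClosed tree_mod :=
  gensub (gens (cut i) `|` range (thread n x i)).

Let slice_thread i : olt le i x -> below i x n (i, n).
Proof. by move=> ix; split=> //=; [exact: wo_refl wo i|left]. Qed.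

Let D_slice i : olt le i x -> D (smod (slice i)).
Proof.
move=> ix; have := D_prod (D_cut ix) (D_M (below_top ix)); apply: D_iso.
have hl : linear (fun p : smod (threads (cut i)) * M i =>
    smod_incl (threads (cut i)) p.1 + thread n x i p.2).
  move=> r [u1 m1] [u2 m2].
  have -> : (r *: (u1, m1) + (u2, m2) : smod _ * M i) = (r *: u1 + u2, r *: m1 + m2) by [].
  by rewrite !linearP scalerDr addrACA.
have hE v m : mklin hl (v, m) = val v + thread n x i m by [].
apply: (iso_range (h := mklin hl)) => [[u m]|u].
  rewrite hE => um0; have m0 : m = 0.
    have := congr1 (dprod_ev (fun q : K * branch => M q.1) (i, n)) um0.
    rewrite linearD linear0 [X in X + _](cut_vanish ix (smod_in u)) add0r.
    by rewrite [LHS](threadT _ (slice_thread ix)) F_id.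
  by move: um0; rewrite m0 linear0 addr0 => u0; congr (_, _); exact: val_inj.
split=> [|[[v m] <-]]; last first.
  rewrite hE rpredD //.
    by apply: gensub_mono (smod_in v) => w; left.
  by apply: gensub_gen; right; exists m.
apply: (gensub_ind (P := fun u => exists p, mklin hl p = u)).
- by exists 0; exact: linear0.
- by move=> r _ _ [p <-] [p' <-]; exists (r *: p + p'); exact: linearP.
- move=> v [vS|[m _ <-]].
    have vS' : v \in threads (cut i) by exact: gensub_gen.
    by exists (Smod vS', 0); rewrite hE linear0 addr0.
  by exists (0, m); rewrite hE add0r.
Qed.

(** The retraction onto slice i: the component at (i, n) tells which thread
    along n, starting at level i, is to be restored after the truncation. *)
Let ret_fun i (u : tree_mod) : tree_mod := trunc n i u + thread n x i (u (i, n)).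
Fact ret_linear i : linear (ret_fun i).
Proof.
move=> r u v; rewrite /ret_fun.
have -> : (r *: u + v) (i, n) = r *: u (i, n) + v (i, n) by [].
by rewrite !linearP scalerDr addrACA.
Qed.
Let ret i : {linear tree_mod -> tree_mod} := mklin (@ret_linear i).

Let retE i u : ret i u = trunc n i u + thread n x i (u (i, n)).
Proof. by []. Qed.

Let ret_slice i u : olt le i x -> u \in threads S' -> ret i u \in slice i.
Proof.
move=> ix uS; rewrite retE rpredD //.
  by apply: gensub_mono (trunc_cut ix uS) => v; left.
by apply: gensub_gen; right; exists (u (i, n)).
Qed.

Let ret_id i u : olt le i x -> u \in slice i -> ret i u = u.
Proof.
move=> ix; apply: (gensub_ind (P := fun u => ret i u = u)).
- exact: linear0.
- by move=> r v w vE wE; rewrite linearP vE wE.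
- move=> v [vS|[m _ <-]]; rewrite retE.
    have vS' : v \in threads (cut i) by exact: gensub_gen.
    by rewrite trunc_id // cut_vanish // linear0 addr0.
  have nn : passes n i (n, x) by split.
  by rewrite (trunc_pass m (below_top ix) nn x_top) /olt (wo_refl wo) add0r
    (threadT _ (slice_thread ix)) F_id.
Qed.

Let slice_sub i : olt le i x -> {subset slice i <= threads S'}.
Proof.
move=> ix; apply: gensub_min => u [uS|[m _ <-]].
  by apply: (threads_mono (S := cut i)) => [t []|]; [left|exact: gensub_gen].
by apply: gens_thread => //; right.
Qed.

Let cut_mono i j : le i j -> cut i `<=` cut j.
Proof.
move=> ij t [St np]; split=> // -[jt ag]; apply: np; split.
  exact: le_olt_trans wo _ _ _ ij jt.
exact: agree_le ij ag.
Qed.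

Let slice_mono i j : olt le j x -> le i j -> {subset slice i <= slice j}.
Proof.
move=> jx ij; have [->//|{}ij] := le_eqVolt wo ij.
apply: gensub_min => u [uS|[m _ <-]].
  apply: gensub_mono (gensub_gen uS) => v [a [y [l [m [Sa yt ly ->]]]]].
  left; exists a, y, l, m; split=> //; exact: cut_mono (oltW wo ij) _ Sa.
rewrite (thread_cut n m ij jx x_top) rpredD //; last first.
  by apply: gensub_gen; right; exists (F i j m).
apply: (@gensub_mono _ _ (gens (cut j))) => [v|]; first by left.
apply: gens_thread => //; last exact: oltW wo _ _ (below_top jx).
by split; [exact: S_below|move=> [/(olt_irr wo)]].
Qed.

Let dominated : (exists t, [/\ S t, le t.2 top & forall i, olt le i x -> passes n i t]) ->
  threads S =i threads S'.
Proof.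
move=> [[a y] /= [Sa yt pa]] u; apply/idP/idP; first by apply: threads_mono => t; left.
apply: gensub_min => v [b [z [i [m [Sb zt iz ->]]]]].
case: Sb => [Sb|[bE zE]]; first exact: gens_thread.
rewrite bE zE in iz *; rewrite (thread_agree (b := a)) //; last first.
  by move=> j /pa [_]; exact: agree_sym.
have xy : le x y by case: (leNolt le x y) => // /pa [/(olt_irr wo)].
have [xE|xy'] := le_eqVolt wo xy; first by rewrite xE in iz *; exact: gens_thread.
have -> : thread a x i m = thread a y i m - thread a y x (F i x m).
  by rewrite (thread_cut a m iz xy' yt) addrK.
by rewrite sub_sub //; apply: gens_thread => //; exact: olt_trans wo _ _ _ iz xy'.
Qed.

Lemma add_node : D (smod (threads S')) /\
  emb_rel k [set` threads S] [set` threads S'].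
Proof.
have [/dominated eqS|ndom] := pselect (exists t,
    [/\ S t, le t.2 top & forall i, olt le i x -> passes n i t]).
  split; first exact: D_iso (iso_smod_eq eqS) D_S.
  have -> : [set` threads S] = [set` threads S'].
    by apply/seteqP; split=> u /=; rewrite eqS.
  exact: emb_rel_refl.
have escape t : S t -> le t.2 top -> exists2 i, olt le i x & cut i t.
  move=> St tt; apply: contrapT => no; apply: ndom; exists t; split=> // i ix.
  by apply: contrapT => np; apply: no; exists i.
have embS i : olt le i x -> emb_rel k [set` threads (cut i)] [set` threads S'].
  move=> ix; apply: emb_rel_split => s sA; exists (trunc n i); split=> [u|u /sA].
    exact: trunc_cut.
  exact: trunc_id.
split; last first.
  apply: (gensub_emb (p := [set i | olt le i x]) (A := fun i => threads (cut i)) wo).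
  - by move=> i j _ _ ij; apply: threads_mono; exact: cut_mono.
  - move=> u [a [y [i [m [Sa yt iy ->]]]]]; have [j jx cj] := escape _ Sa yt.
    by exists j => //; exact: gens_thread.
  - by move=> i _; apply: threads_mono => t [].
  - exact: embS.
pose p : set K := [set i | olt le i x].
have layerE j (Lj := layer set0 (fun i => [set` slice i]) [set i | le i j]) :
    olt le j x -> slice j =i Lj.
  move=> jx u; apply/idP/idP => [uj|].
    by apply: gensub_gen; right; exists j => //=; exact: wo_refl wo j.
  apply: gensub_min => v [//|[i ij]]; exact: slice_mono.
have [] := @build _ D k closed _ _ le wo set0 (fun i => [set` slice i]) p.
- by move=> i j ij; exact: le_olt_trans wo _ _ _ ij.
- apply: D_iso D_zero; apply/iso_sym/iso_zero => u; apply: val_inj.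
  apply: (gensub_ind (P := fun u => u = 0)) (smod_in u) => //.
    by move=> r y z -> ->; rewrite scaler0 addr0.
  by move=> v [//|[]].
- move=> j jx _; split; first exact: D_iso (iso_smod_eq (layerE j jx)) (D_slice jx).
  have <- : [set` slice j] = [set` layer set0 (fun i => [set` slice i]) [set i | le i j]].
    by apply/seteqP; split=> u /=; rewrite layerE.
  apply: (gensub_emb (p := [set i | olt le i j]) (A := slice) wo).
  + move=> i l _ lj; apply: slice_mono; exact: olt_trans wo _ _ _ lj jx.
  + by move=> u [//|[i ij ui]]; exists i.
  + by move=> i ij u ui; apply: gensub_gen; right; exists i.
  + move=> i ij; have ix := olt_trans wo ij jx.
    apply: emb_rel_split => s sA; exists (ret i); split=> [u uj|u /sA].
      by apply: ret_slice => //; exact: slice_sub uj.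
    exact: ret_id.
- move=> DL _; apply: D_iso DL; apply: iso_smod_eq => u; apply/idP/idP.
    apply: gensub_min => v [//|[i ix]]; exact: slice_sub.
  apply: gensub_min => v [a [y [i [m [Sa yt iy ->]]]]].
  case: Sa => [Sa|[aE yE]]; last first.
    rewrite aE yE in iy *; apply: gensub_gen; right; exists i => //.
    by apply: gensub_gen; right; exists m.
  have [j jx cj] := escape _ Sa yt.
  apply: gensub_gen; right; exists j => //.
  by apply: gensub_gen; left; exists a, y, i, m.
Qed.

End AddNode.


Lemma gens_bigcup (I : Type) (q : set I) (S : I -> set node) :
  gens (\bigcup_(i in q) S i) = \bigcup_(i in q) gens (S i).
Proof.
apply/seteqP; split=> [u [a [x [i [m [[j qj Sj] xt ix ->]]]]]|u [j qj]].
  by exists j => //; exists a, x, i, m.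
by move=> [a [x [i [m [Sj xt ix ->]]]]]; exists a, x, i, m; split=> //; exists j.
Qed.

Lemma gensU (S S' : set node) : gens (S `|` S') = gens S `|` gens S'.
Proof.
apply/seteqP; split=> [u [a [x [i [m [[Sa|Sa] xt ix ->]]]]]|u [|]].
- by left; exists a, x, i, m.
- by right; exists a, x, i, m.
- by move=> [a [x [i [m [Sa xt ix ->]]]]]; exists a, x, i, m; split=> //; left.
- by move=> [a [x [i [m [Sa xt ix ->]]]]]; exists a, x, i, m; split=> //; right.
Qed.

Definition levels (q : set K) : set node := [set t | q t.2].

(** The nodes of level x are added one by one, in the order of some well-ordering
    of all branches. *)
Lemma add_level x : le x top -> D (smod (threads (levels [set y | olt le y x]))) ->
  D (smod (threads (levels [set y | le y x]))) /\
  emb_rel k [set` threads (levels [set y | olt le y x])]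
            [set` threads (levels [set y | le y x])].
Proof.
move=> xt Dlt; have [leB woB] := wochoice.well_ordering_principle (classicType branch).
pose B0 := gens (levels [set y | olt le y x]).
pose lay (q : set branch) := layer B0 (fun n => gens [set (n, x)]) q.
have layE q : lay q = threads (levels [set y | olt le y x] `|` \bigcup_(n in q) [set (n, x)]).
  by rewrite /threads gensU gens_bigcup.
have lay0 : lay set0 = threads (levels [set y | olt le y x]).
  by rewrite layE bigcup_set0 setU0.
have layT : lay setT = threads (levels [set y | le y x]).
  rewrite layE; congr threads; apply/seteqP; split=> [[a y] [yx|[n _ [-> ->]]]|[a y] yx].
  - exact: oltW wo _ _ yx.
  - exact: wo_refl wo x.
  - have [->|] := le_eqVolt wo (yx : le y x); last by left.
    by right; exists a.
rewrite -lay0 -layT; apply: (build closed woB) => //.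
  by rewrite -/(lay set0) lay0.
move=> n _; rewrite -!/(lay _) => Dn.
have -> : lay [set s | leB s n] = threads ((levels [set y | olt le y x] `|`
    \bigcup_(b in [set s | olt leB s n]) [set (b, x)]) `|` [set (n, x)]).
  rewrite layE -setUA; congr (threads (_ `|` _)); apply/seteqP; split=> [t|t].
    move=> [b bn ->]; have [->|bn'] := le_eqVolt woB (bn : leB b n); first by right.
    by left; exists b.
  move=> [[b bn ->]|->]; first by exists b => //; exact: (oltW woB bn).
  by exists n => //; exact: wo_refl woB n.
rewrite layE in Dn *; apply: add_node => //.
- move=> a y z [yx|[b _ [-> ->]]] zy; left => //.
  exact: olt_trans wo _ _ _ zy yx.
- by move=> y yx; left.
Qed.

Lemma D_threads : D (smod (threads (levels [set y | le y top]))).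
Proof.
pose lay (q : set K) := layer set0 (fun x => gens [set t | t.2 = x]) q.
have layE q : lay q = threads (levels q).
  rewrite /lay /layer set0U -gens_bigcup; congr threads.
  apply/seteqP; split=> [[a x] [y qy /= ->]//|[a x] qx].
  by exists x.
rewrite -layE; apply: (build closed wo _ _ _).1 => [x y xy|| x xt].
- exact: wo_trans wo _ _ _ xy.
- apply: D_iso D_zero; apply/iso_sym/iso_zero => u; apply: val_inj.
  apply: (gensub_ind (P := fun u => u = 0)) (smod_in u) => //.
    by move=> r y z -> ->; rewrite scaler0 addr0.
  by move=> v [//|[]].
- by rewrite -!/(lay _) !layE; exact: add_level.
Qed.

(** ** The colimit as a direct summand of a quotient *)

Hypothesis top_surj : forall m : M top,
  exists i, olt le i top /\ exists m', F i top m' = m.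
Hypothesis top_ker : forall i (m : M i), olt le i top -> F i top m = 0 ->
  exists j, [/\ le i j, olt le j top & F i j m = 0].

Let X := threads (levels [set y | le y top]).
Let low := threads (levels [set y | olt le y top]).

Let below_topE a i : olt le i top -> below i top a (top, a).
Proof. by move=> it; split=> //=; [exact: oltW wo _ _ it|right]. Qed.

Let low_ev a u : u \in low -> u (top, a) = 0.
Proof.
apply: (gensub_ind (P := fun u : tree_mod => u (top, a) = 0)) => // [r v w vE wE|].
  have -> : (r *: v + w) (top, a) = r *: v (top, a) + w (top, a) by [].
  by rewrite vE wE scaler0 addr0.
move=> v [b [x [i [m [xt _ ix ->]]]]]; rewrite threadF // => -[_ [tx|[xE _]] _].
  by have := olt_trans wo tx xt => /(olt_irr wo).
by move: (xt : olt le x top); rewrite xE => /(olt_irr wo).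
Qed.

Let thread_low a i j (m : M i) : olt le i top -> olt le j top -> le i j ->
  thread a top i m - thread a top j (F i j m) \in low.
Proof.
move=> it jt ij; have [<-|ij'] := le_eqVolt wo ij; first by rewrite F_id subrr rpred0.
rewrite (thread_cut a m ij' jt (wo_refl wo top)) addrK.
by apply: gens_thread => //; exact: oltW wo _ _ jt.
Qed.

(** By thread_cut, a thread that reaches top can be made to start later, modulo
    threads that stop; so finitely many of them can start at one level. *)
Let branch_low a u : u \in threads [set (a, top)] ->
  exists i, olt le i top /\ exists m, u - thread a top i m \in low.
Proof.
apply: (gensub_ind (P := fun u => exists i, olt le i top /\
  exists m, u - thread a top i m \in low)).
- have [i it] := top_limit.1; exists i; split=> //; exists 0.
  by rewrite linear0 subrr rpred0.
- move=> r u1 u2 [i1 [it1 [m1 h1]]] [i2 [it2 [m2 h2]]].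
  have lift i j m v : olt le i top -> olt le j top -> le i j ->
      v - thread a top i m \in low -> v - thread a top j (F i j m) \in low.
    move=> it jt ij vl; rewrite -(subrK (thread a top i m) v) -addrA rpredD //.
    exact: thread_low.
  have [j [jt [i1j i2j]]] : exists j, olt le j top /\ le i1 j /\ le i2 j.
    by have [ii|ii] := wo_total wo i1 i2; [exists i2|exists i1]; rewrite ii (wo_refl wo).
  exists j; split=> //; exists (r *: F i1 j m1 + F i2 j m2).
  have e1 := lift _ _ _ _ it1 jt i1j h1; have e2 := lift _ _ _ _ it2 jt i2j h2.
  by rewrite linearP opprD addrACA -scalerBr sub_lin.
- move=> v [b [x [i [m [[-> ->] xt ix ->]]]]]; exists i; split=> //; exists m.
  by rewrite subrr rpred0.
Qed.

(** Modulo the threads that stop, the threads along a that reach top form a copy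
    of M top, and the component at (top, a) is a retraction onto it. This remains
    true modulo H as long as this component vanishes on H. *)
Lemma top_summand (a : branch) (H : submodClosed (smod X)) :
  (forall u, val u \in low -> u \in H) ->
  (forall u, u \in H -> val u (top, a) = 0) -> D (qmod H) -> D (M top).
Proof.
move=> lowH Ha DH.
pose r : {linear smod X -> M top} :=
  dprod_ev (fun q : K * branch => M q.1) (top, a) \o smod_incl X.
have rE u : r u = val u (top, a) by [].
have tE i (m : M i) : olt le i top -> thread a top i m (top, a) = F i top m.
  by move=> it; exact: threadT _ (below_topE a it).
have [|m|u ua|B BP] := @quotient_summand _ _ _ H (inside X (threads [set (a, top)])) r.
- by move=> u /Ha.
- have [i [it [m' mE]]] := top_surj m.
  have tX : thread a top i m' \in X by apply: gens_thread => //; exact: wo_refl wo top.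
  exists (Smod tX); last by rewrite rE [LHS]tE.
  by rewrite inside_in; apply: gens_thread => //; exact: wo_refl wo top.
- rewrite rE => u0; apply: lowH; have [i [it [m um]]] := branch_low ua.
  have Fm : F i top m = 0.
    have := low_ev a um; have -> (f g : tree_mod) : (f - g) (top, a) = f (top, a) - g (top, a) by [].
    by rewrite u0 tE // sub0r => /eqP; rewrite oppr_eq0 => /eqP.
  have [j [ij jt Fj]] := top_ker it Fm.
  rewrite -(subrK (thread a top i m) (val u)) rpredD //.
  by have := thread_low a m it jt ij; rewrite Fj linear0 subr0.
- exact: D_summand BP DH.
Qed.

End Tree.

(** * Well-ordered colimits *)
Section ChainLimit.
Variables (R : pzRingType) (D : rmodType R -> Prop) (k : embedding_kind).
Hypothesis D_iso : forall A B, isomorphic A B -> D A -> D B.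
Hypothesis D_zero : D (zero_mod R).
Hypothesis D_prod : forall A B : rmodType R, D A -> D B -> D (A * B)%type.
Hypothesis D_summand : closed_direct_summands D.
Hypothesis closed : chain_closed D k.
Variable V : small.
Hypothesis D_closed : forall N : rmodType R, D N -> exists c : N -> V -> N,
  forall H : submodClosed N, (forall x v, x \in H -> c x v \in H) ->
  D (smod H) /\ D (qmod H).

Variables (K : small) (le : rel K) (top : K).
Hypotheses (wo : wochoice.well_order le) (top_limit : is_limit le top).
Variables (M : K -> rmodType R) (F : forall i j, {linear M i -> M j}).
Hypothesis F_id : forall i x, F i i x = x.
Hypothesis F_comp : forall i j l x, le i j -> le j l -> F j l (F i j x) = F i l x.
Hypothesis D_M : forall i, olt le i top -> D (M i).
Hypothesis top_surj : forall m : M top,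
  exists i, olt le i top /\ exists m', F i top m' = m.
Hypothesis top_ker : forall i (m : M i), olt le i top -> F i top m = 0 ->
  exists j, [/\ le i j, olt le j top & F i j m = 0].

(** The operations that generate the submodule H of the next proof. *)
Inductive label := Add | Scale of R | Choose of V.

(** Let X be the module of all threads, and H its smallest submodule that contains
    the threads stopping below top and is closed under the function c of the
    hypothesis D_closed. Its elements are the values of terms whose leaves are
    nodes, finitely many, of levels < top; an element of X has a nonzero
    component at (top, a) for finitely many branches a only. As there are more
    branches than nodes, or terms in them, some component at (top, a) vanishes
    on H, and M top is a direct summand of X/H. *)
Lemma chain_limit : D (M top).
Proof.
pose W (N : small) : small :=
  (term (N * {x : K & {i : K & M i}}) label * nat)%type.
have [Y YP] := koenig_family wo W.
have inh i : exists y : Y i, True by have [[y] _] := YP i; exists y.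
pose y0 i : Y i := sval (cid (inh i)).
pose N i : small := forall j, olt le j i -> Y j.
pose ext i (s : N i) : branch Y :=
  fun j => if pselect (olt le j i) is left h then s j h else y0 j.
pose res i (b : branch Y) : N i := fun j _ => b j.
have ext_res i b : agree le i (ext i (res i b)) b.
  by move=> j ji; rewrite /ext; case: pselect.
pose T := threads le top F (Y := Y); pose lev := levels (Y := Y).
pose X := T (lev [set y | le y top]); pose low := T (lev [set y | olt le y top]).
have DX : D (smod X).
  exact: (D_threads D_iso D_zero D_prod D_summand closed wo top_limit F_id F_comp D_M Y).
have [c cP] := D_closed DX.
pose c' (u : tree_mod M Y) v : tree_mod M Y :=
  if pselect (u \in X) is left uX then val (c (Smod uX) v) else 0.
have c'E u v : val (c u v) = c' (val u) v.
  rewrite /c'; case: pselect => [uX|nuX]; last by case: nuX; exact: smod_in.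
  by congr (val (c _ _)); apply: val_inj.
pose op (l : label) (s : seq (tree_mod M Y)) : tree_mod M Y :=
  match l with
  | Add => s`_0 + s`_1
  | Scale r => (r : R^c) *: s`_0
  | Choose v => c' s`_0 v
  end.
pose arg i (p : N i * {x : K & {j : K & M j}}) : tree_mod M Y :=
  let: existT x (existT j m) := p.2 in
  if le x i && olt le j x then thread le top F (ext i p.1) x j m else 0.
pose ev i := eval 0 (arg i) op.
have ev_leaf i b x j (m : M j) : olt le i top -> le x i -> olt le j x ->
    exists t, ev i t = thread le top F b x j m.
  move=> it xi jx; have xt := wo_trans wo xi (oltW wo it).
  exists (GenTree.Leaf (inl (res i b, existT _ x (existT _ j m)))).
  rewrite /ev /= /arg /= xi jx; apply: (thread_agree top_limit F) => // l lx.
  exact: (agree_le wo (wo_trans wo (oltW wo lx) xi) (ext_res i b)).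
have ev_op i l ts : ev i (app l ts) = op l (map (ev i) ts) by [].
(* a term in nodes of level i can be rewritten with nodes of level i' *)
have ev_mono i i' t : le i i' -> olt le i' top -> exists t', ev i' t' = ev i t.
  move=> ii' it'; apply: (eval_ind (P := fun u => exists t', ev i' t' = u)).
  - by exists (GenTree.Node 0 [::]).
  - move=> [s [x [j m]]]; rewrite /arg /=; case: ifP => [/andP[xi jx]|_].
      by apply: ev_leaf => //; exact: wo_trans wo _ _ _ xi ii'.
    by exists (GenTree.Node 0 [::]).
  - by move=> l s /eval_seq [ts <-]; exists (app l ts).
pose P u := exists i, olt le i top /\ exists t, ev i t = u.
have P0 : P 0.
  have [i it] := top_limit.1; exists i; split=> //; by exists (GenTree.Node 0 [::]).
have PZ r u : P u -> P (r *: u).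
  move=> [i [it [t <-]]]; exists i; split=> //.
  by exists (app (Scale r) [:: t]).
have PD u u' : P u -> P u' -> P (u + u').
  move=> [i [it [t <-]]] [i' [it' [t' <-]]].
  have [j [jt ij i'j]] : exists j, [/\ olt le j top, le i j & le i' j].
    have [ii|ii] := wo_total wo i i'; [exists i'|exists i]; split=> //; exact: wo_refl.
  have [s <-] := ev_mono _ _ t ij jt; have [s' <-] := ev_mono _ _ t' i'j jt.
  by exists j; split=> //; exists (app Add [:: s; s']).
have Pl r u u' : P u -> P u' -> P (r *: u + u') by move=> /(PZ r); exact: PD.
pose HS := psub P0 Pl; have HSE u : u \in HS <-> P u by exact: psubE.
have HS_closed u v : u \in inside X HS -> c u v \in inside X HS.
  rewrite !inside_in => /HSE [i [it [t tu]]]; apply/HSE.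
  exists i; split=> //; exists (app (Choose v) [:: t]).
  by rewrite ev_op /= tu c'E.
have lowHS u : u \in low -> u \in HS.
  apply: gensub_min => v [b [x [j [m [xt xt' jx ->]]]]]; apply/HSE.
  exists x; split=> //; have [t <-] := ev_leaf x b x j m xt (wo_refl wo x) jx.
  by exists t.
have fin u : u \in X -> exists s : seq (classicType (branch Y)),
    forall a, u (top, a) <> 0 -> exists2 b, b \in s & agree le top a b.
  apply: (gensub_ind (P := fun u : tree_mod M Y =>
    exists s : seq (classicType (branch Y)), forall a, u (top, a) <> 0 ->
      exists2 b, b \in s & agree le top a b)).
  - by exists [::].
  - move=> r v w [s sP] [s' s'P]; exists (s ++ s') => a vw.
    have [v0|/sP [b bs ab]] := pselect (v (top, a) = 0); last first.
      by exists b; rewrite // mem_cat bs.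
    have [w0|/s'P [b bs ab]] := pselect (w (top, a) = 0); last first.
      by exists b; rewrite // mem_cat bs orbT.
    case: vw; have -> : (r *: v + w) (top, a) = r *: v (top, a) + w (top, a) by [].
    by rewrite v0 w0 scaler0 addr0.
  - move=> v [b [x [j [m [xt xt' jx ->]]]]]; exists [:: b] => a na; exists b.
      exact: mem_head.
    by apply: contrapT => nab; apply: na; apply: threadF => -[_ _].
have /choice [supp suppP] : forall u, exists s : seq (classicType (branch Y)),
    u \in X -> forall a, u (top, a) <> 0 -> exists2 b, b \in s & agree le top a b.
  move=> u; have [/fin [s sP]|nuX] := boolP (u \in X); last by exists [::].
  by exists s.
(* all the branches that an element of H involves, enumerated by the terms of
   each level; the branch a of the diagonal argument is not among them *)
pose b0 : branch Y := y0.
pose h i (w : W (N i)) : Y i := nth b0 (supp (ev i w.1)) w.2 i.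
have yP i : exists y, forall w, h i w <> y by exact: (YP i).2.
pose a : branch Y := fun i => sval (cid (yP i)).
apply: (top_summand D_summand wo top_limit F_id F_comp top_surj top_ker
  (a := a) (H := inside X HS)).
- by move=> u ul; rewrite inside_in; exact: lowHS.
- move=> u; rewrite inside_in => /HSE [i [it [t tu]]].
  apply: contrapT => /(suppP _ (smod_in u)) [b bs ab].
  apply: (svalP (cid (yP i)) (t, index b (supp (val u)))).
  rewrite /h /= tu (nth_index (b0 : classicType (branch Y)) bs).
  exact/esym/(ab i it).
- by apply: (cP _ _).2 => u v; exact: HS_closed.
Qed.
End ChainLimit.

(** * Directed colimits *)

(** By induction on the size of s: e s is an upper bound of s and of all the e t,
    for t a proper subset of s. *)
Lemma fset_bound (T : choiceType) (le : rel T) :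
  (forall x, le x x) -> (forall x y z, le x y -> le y z -> le x z) ->
  (exists x : T, True) -> (forall x y, exists z, le x z /\ le y z) ->
  exists e : {fset T} -> T,
    (forall s s' : {fset T}, (s `<=` s')%fset -> le (e s) (e s')) /\
    forall (s : {fset T}) x, x \in s -> le x (e s).
Proof.
move=> refl trans [x0 _] dir.
have /choice [ub ubP] : forall s : seq T, exists b, forall x, x \in s -> le x b.
  elim=> [|x s [b bP]]; first by exists x0.
  have [z [xz bz]] := dir x b; exists z => y; rewrite inE => /orP [/eqP -> //|/bP yb].
  exact: trans yb bz.
pose fix E (n : nat) (s : {fset T}) {struct n} : T := if n is n'.+1 then
  if (#|` s| <= n')%N then E n' s else
  ub (enum_fset s ++ [seq E n' t | t <- enum_fset (fpowerset s) & t != s])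
  else ub [::].
pose e (s : {fset T}) := E #|` s| s.
have EE n (s : {fset T}) : (#|` s| <= n)%N -> E n s = e s.
  elim: n => [|n IH]; first by rewrite leqn0 /e => /eqP ->.
  rewrite leq_eqVlt => /orP [/eqP <- //|]; rewrite ltnS => sn.
  by rewrite /= sn IH.
have eE (s : {fset T}) : #|` s| != 0%N ->
    e s = ub (enum_fset s ++ [seq e t | t : {fset T} <- enum_fset (fpowerset s) & t != s]).
  rewrite /e; case sn : #|` s| => [//|n] _ /=; rewrite sn ltnn.
  congr (ub (_ ++ _)); apply/eq_in_map => t; rewrite mem_filter => /andP [ts].
  rewrite fpowersetE => tsub; apply: EE; rewrite -ltnS -sn.
  by apply: fproper_ltn_card; rewrite fproperEneq ts.
exists e; split=> [s s' ss'|s x xs].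
  have [-> //|ne] := eqVneq s s'.
  rewrite (eE s'); last first.
    apply: contraNneq ne => s'0; have /eqP := s'0; rewrite cardfs_eq0 => /eqP s'E.
    by move: ss'; rewrite s'E fsubset0.
  apply: ubP; rewrite mem_cat; apply/orP; right; apply: map_f.
  by rewrite mem_filter ne /= fpowersetE.
rewrite (eE s); last by apply: contraTneq xs => /eqP; rewrite cardfs_eq0 => /eqP ->.
by apply: ubP; rewrite mem_cat xs.
Qed.

Lemma unit_wo : wochoice.well_order (fun _ _ : unit => true).
Proof. by move=> P [[] P1]; exists tt; split=> [|[]//]; split. Qed.

Section Colim.
Variables (R : pzRingType) (I : small) (le : rel I).
Hypothesis le_refl : forall i, le i i.
Hypothesis le_trans : forall i j l, le i j -> le j l -> le i l.
Variables (M : I -> rmodType R) (F : forall i j, {linear M i -> M j}).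
Hypothesis F_id : forall i x, F i i x = x.
Hypothesis F_comp : forall i j l x, le i j -> le j l -> F j l (F i j x) = F i l x.
Implicit Types P Q : set I.

Definition updirected P := (exists i, P i) /\
  forall i j, P i -> P j -> exists l, [/\ P l, le i l & le j l].

(** The colimit of the restriction of the system to P. This description by
    elements, rather than by the universal property, lends itself to proofs; the
    two agree by colim_univ and lim_colim. *)
Record colim P (L : rmodType R) (phi : forall i, {linear M i -> L}) : Prop := Colim {
  colim_compat : forall i j x, P i -> P j -> le i j -> phi j (F i j x) = phi i x;
  colim_surj : forall y, exists i, P i /\ exists x, phi i x = y;
  colim_ker : forall i x, P i -> phi i x = 0 ->
    exists j, [/\ P j, le i j & F i j x = 0] }.

Section Universal.
Variables (P : set I) (L : rmodType R) (phi : forall i, {linear M i -> L}).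
Hypotheses (dirP : updirected P) (Lphi : colim P phi).

Lemma colim_eq i j x y : P i -> P j -> phi i x = phi j y ->
  exists l, [/\ P l, le i l, le j l & F i l x = F j l y].
Proof.
move=> Pi Pj xy; have [l [Pl il jl]] := dirP.2 _ _ Pi Pj.
have [|l' [Pl' ll' z]] := colim_ker Lphi (i := l) (x := F i l x - F j l y) Pl.
  by rewrite linearB /= !(colim_compat Lphi) // xy subrr.
exists l'; split=> //; [exact: le_trans ll'|exact: le_trans ll'|].
by move/eqP: z; rewrite linearB /= !F_comp // subr_eq0 => /eqP.
Qed.

Lemma colim_univ (N : rmodType R) (psi : forall i, {linear M i -> N}) :
  (forall i j x, P i -> P j -> le i j -> psi j (F i j x) = psi i x) ->
  exists u : {linear L -> N}, forall i x, P i -> u (phi i x) = psi i x.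
Proof.
move=> compat.
have /choice [u uP] : forall y, exists z, forall i x, P i -> phi i x = y -> psi i x = z.
  move=> y; have [i [Pi [x xy]]] := colim_surj Lphi y; exists (psi i x) => j x' Pj x'y.
  have [|l [Pl jl il e]] := @colim_eq j i x' x Pj Pi; first by rewrite x'y xy.
  by rewrite -(compat _ _ _ Pj Pl jl) e compat.
have uE i x : P i -> u (phi i x) = psi i x by move=> Pi; rewrite -(uP (phi i x) i x).
have ul : linear u.
  move=> r y z; have [i [Pi [x <-]]] := colim_surj Lphi y.
  have [j [Pj [x' <-]]] := colim_surj Lphi z.
  have [l [Pl il jl]] := dirP.2 _ _ Pi Pj.
  rewrite -(colim_compat Lphi _ Pi Pl il) -(colim_compat Lphi _ Pj Pl jl).
  by rewrite -linearP !uE // linearP.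
by exists (mklin ul).
Qed.
End Universal.

Lemma colim_iso P L phi L' phi' : updirected P ->
  @colim P L phi -> @colim P L' phi' -> isomorphic L L'.
Proof.
move=> dirP Lc L'c.
have [u uE] := colim_univ dirP Lc (fun i j x => colim_compat L'c (i := i) (j := j) x).
apply: (isoI (f := u)) => [y|y].
  have [i [Pi [x <-]]] := colim_surj Lc y; rewrite uE // => /(colim_ker L'c Pi).
  by move=> [j [Pj ij x0]]; rewrite -(colim_compat Lc _ Pi Pj ij) x0 linear0.
have [i [Pi [x <-]]] := colim_surj L'c y.
by exists (phi i x); rewrite uE.
Qed.

(** ** Existence *)

(** The elements of the colimit are families, up to those that vanish eventually;
    the class of x in M i is that of the family of the F i j x, in which only the
    indices j above i count. *)
Definition germ_fun i (x : M i) : dprod M := fun j => F i j x.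
Fact germ_linear i : linear (@germ_fun i).
Proof. by move=> r x y; apply: dprodP => j; exact: linearP. Qed.
Definition germ i : {linear M i -> dprod M} := mklin (@germ_linear i).

Definition vanishing P : submodClosed (dprod M) :=
  gensub [set u : dprod M | exists i, P i /\ forall j, P j -> le i j -> u j = 0].

Lemma vanishingP P u : updirected P -> u \in vanishing P ->
  exists i, P i /\ forall j, P j -> le i j -> u j = 0.
Proof.
move=> [[i0 Pi0] dir]; apply: (gensub_ind (P := fun u : dprod M =>
  exists i, P i /\ forall j, P j -> le i j -> u j = 0)) => //.
  by exists i0.
move=> r v w [i [Pi vi]] [j [Pj wj]]; have [l [Pl il jl]] := dir _ _ Pi Pj.
exists l; split=> // m Pm lm.
have -> : (r *: v + w) m = r *: v m + w m by [].
by rewrite vi ?wj ?scaler0 ?addr0 //; exact: le_trans lm.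
Qed.

Definition lim_sub P : submodClosed (qmod (vanishing P)) :=
  gensub (\bigcup_(i in P) range (qpi (vanishing P) \o germ i)).

Definition colim_mod P : rmodType R := smod (lim_sub P).

Lemma lim_colim P : updirected P -> exists phi, @colim P (colim_mod P) phi.
Proof.
move=> dirP; pose g i : {linear M i -> qmod (vanishing P)} := qpi (vanishing P) \o germ i.
have gP i : P i -> forall x, g i x \in lim_sub P.
  by move=> Pi x; apply: gensub_gen; exists i => //; exists x.
have zl i : linear (fun _ : M i => 0 : colim_mod P).
  by move=> r x y; rewrite scaler0 addr0.
pose phi i : {linear M i -> colim_mod P} :=
  if pselect (P i) is left Pi then corestrict (gP i Pi) else mklin (zl i).
have phiE i x : P i -> val (phi i x) = g i x.
  by rewrite /phi; case: pselect.
have compat i j x : P i -> P j -> le i j -> g j (F i j x) = g i x.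
  move=> Pi Pj ij; apply/qpi_eq; apply: gensub_gen; exists j; split=> // l Pl jl.
  have -> : (germ j (F i j x) - germ i x) l = F j l (F i j x) - F i l x by [].
  by rewrite F_comp // subrr.
exists phi; split=> [i j x Pi Pj ij|y|i x Pi xi].
- by apply: val_inj; rewrite !phiE // compat.
- suff [i [Pi [x xy]]] : exists i, P i /\ exists x, g i x = val y.
    by exists i; split=> //; exists x; apply: val_inj; rewrite phiE.
  apply: (gensub_ind (P := fun y => exists i, P i /\ exists x, g i x = y)) (smod_in y).
  + by have [i Pi] := dirP.1; exists i; split=> //; exists 0; exact: linear0.
  + move=> r _ _ [i [Pi [x <-]]] [j [Pj [x' <-]]].
    have [l [Pl il jl]] := dirP.2 _ _ Pi Pj.
    exists l; split=> //; exists (r *: F i l x + F j l x').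
    by rewrite linearP !compat.
  + by move=> z [i Pi [x _ <-]]; exists i; split=> //; exists x.
- have /qpi_eq0 /(vanishingP dirP) [j [Pj jx]] : g i x = 0.
    by rewrite -phiE // xi linear0.
  have [l [Pl il jl]] := dirP.2 _ _ Pi Pj.
  by exists l; split=> //; exact: jx.
Qed.

Section Good.
Variable D : rmodType R -> Prop.
Hypothesis D_iso : forall A B, isomorphic A B -> D A -> D B.
Hypothesis D_chain : forall (K : small) (leK : rel K) (top : K)
  (N : K -> rmodType R) (G : forall i j, {linear N i -> N j}),
  wochoice.well_order leK -> is_limit leK top ->
  (forall i x, G i i x = x) ->
  (forall i j l x, leK i j -> leK j l -> G j l (G i j x) = G i l x) ->
  (forall i, olt leK i top -> D (N i)) ->
  (forall m : N top, exists i, olt leK i top /\ exists m', G i top m' = m) ->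
  (forall i (m : N i), olt leK i top -> G i top m = 0 ->
     exists j, [/\ leK i j, olt leK j top & G i j m = 0]) ->
  D (N top).

Lemma lim_chain (K : small) (leK : rel K) (top : K) (P : K -> set I) :
  wochoice.well_order leK -> is_limit leK top -> (forall a, updirected (P a)) ->
  (forall a b, leK a b -> P a `<=` P b) ->
  (forall i, P top i -> exists2 a, olt leK a top & P a i) ->
  (forall a, olt leK a top -> D (colim_mod (P a))) -> D (colim_mod (P top)).
Proof.
move=> wo tl dirP mono Ptop DP.
pose phi a := sval (cid (lim_colim (dirP a))).
have phiP a : colim (P a) (phi a) by exact: (svalP (cid (lim_colim (dirP a)))).
have uex a b : leK a b -> exists u : {linear colim_mod (P a) -> colim_mod (P b)},
    forall i x, P a i -> u (phi a i x) = phi b i x.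
  move=> ab; apply: (colim_univ (dirP a) (phiP a)) => i j x Pi Pj ij.
  by apply: (colim_compat (phiP b)) => //; exact: (mono a b ab).
have zl a b : linear (fun _ : colim_mod (P a) => 0 : colim_mod (P b)).
  by move=> r x y; rewrite scaler0 addr0.
pose G a b : {linear colim_mod (P a) -> colim_mod (P b)} :=
  if pselect (leK a b) is left ab then sval (cid (uex a b ab)) else mklin (zl a b).
have GE a b i x : leK a b -> P a i -> G a b (phi a i x) = phi b i x.
  move=> ab; rewrite /G; case: pselect => // ab'.
  exact: (svalP (cid (uex a b ab'))).
apply: (D_chain (N := fun a => colim_mod (P a)) (G := G) wo tl) => //.
- move=> a y; have [i [Pi [x <-]]] := colim_surj (phiP a) y.
  by rewrite GE //; exact: wo_refl.
- move=> a b c y ab bc; have [i [Pi [x <-]]] := colim_surj (phiP a) y.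
  rewrite !GE //; first exact: wo_trans ab bc.
  exact: mono ab _ Pi.
- move=> y; have [i [Pi [x <-]]] := colim_surj (phiP top) y.
  have [a at_ Pai] := Ptop i Pi; exists a; split=> //.
  by exists (phi a i x); rewrite GE //; exact: oltW.
- move=> a y at_; have [i [Pi [x <-]]] := colim_surj (phiP a) y.
  rewrite GE //; last exact: oltW.
  have aP : leK a top by exact: oltW.
  move=> /(colim_ker (phiP top) (mono _ _ aP _ Pi)) [j [Pj ij x0]].
  have [b bt Pbj] := Ptop j Pj.
  have [c [ct ac bc]] : exists c, [/\ olt leK c top, leK a c & leK b c].
    by have [?|?] := wo_total wo a b; [exists b|exists a]; split=> //; exact: wo_refl.
  exists c; split=> //; rewrite GE //.
  rewrite -(colim_compat (phiP c) (j := j)) ?x0 ?linear0 //.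
    exact: mono ac _ Pi.
  exact: mono bc _ Pbj.
Qed.

Hypothesis D_M : forall i, D (M i).
Hypothesis dirT : updirected setT.

(** Let P e a be the part of I that lies below some e s, where s is a finite set
    of elements < a in a well-ordering of I. For a limit a, the colimit over
    P e a is the colimit of a well-ordered system of such colimits. For
    the successor a of x, the part P e a is P e' x, where e' s = e (x |` s). So the
    induction on a deals with all monotone e at once, and it needs
    no comparison of cardinals. At the end, a is an additional greatest element
    and P e a is all of I. *)
Lemma lim_directed : D (colim_mod setT).
Proof.
pose T := classicType I.
have [e0 [e0mono e0bound]] : exists e : {fset T} -> I,
    (forall s s' : {fset T}, (s `<=` s')%fset -> le (e s) (e s')) /\
    forall (s : {fset T}) x, x \in s -> le x (e s).
  apply: (@fset_bound T le) => //; first by have [[i _] _] := dirT; exists i.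
  by move=> i j; have [l [_ il jl]] := dirT.2 i j Logic.I Logic.I; exists l.
have [leI woI] := wochoice.well_ordering_principle T.
pose K := (I + unit)%type; pose leK : rel K := sum_le leI (fun _ _ : unit => true).
have woK : wochoice.well_order leK by exact: sum_wo woI unit_wo.
pose incr (e : {fset T} -> I) := forall s s' : {fset T}, (s `<=` s')%fset -> le (e s) (e s').
pose small_fset (a : K) (s : {fset T}) := forall x : T, x \in s -> olt leK (inl (x : I)) a.
pose P (e : {fset T} -> I) (a : K) : set I :=
  [set i | exists s, small_fset a s /\ le i (e s)].
have dirP e a : incr e -> updirected (P e a).
  move=> emono; split.
    by exists (e fset0), fset0; split=> // x; rewrite in_fset0.
  move=> i j [s [sa is_]] [s' [s'a js]]; exists (e (s `|` s')%fset); split.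
  - by exists (s `|` s')%fset; split=> // x; rewrite in_fsetU => /orP [/sa|/s'a].
  - by apply: le_trans is_ _; apply: emono; exact: fsubsetUl.
  - by apply: le_trans js _; apply: emono; exact: fsubsetUr.
have main a : forall e, incr e -> D (colim_mod (P e a)).
  elim/(wo_ind woK): a => a IH e emono.
  have [a0|[b ba]|al] := zero_succ_limit leK a.
  - have e0P i : P e a i -> le i (e fset0).
      move=> [s [sa is_]]; suff <- : s = fset0 by [].
      apply/fsetP => x; rewrite in_fset0; apply/negP => /sa.
      by rewrite /olt a0.
    apply: D_iso (D_M (e fset0)).
    have [phi phiP] := lim_colim (dirP e a emono).
    apply: (colim_iso (dirP e a emono) _ phiP (phi := fun i => F i (e fset0))).
    have Pe : P e a (e fset0) by exists fset0; split=> // x; rewrite in_fset0.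
    split=> [i j x Pi Pj ij|y|i x Pi xi].
    + by apply: F_comp => //; exact: e0P.
    + by exists (e fset0); split=> //; exists y.
    + by exists (e fset0); split=> //; exact: e0P.
  - case: b ba => [x|[]] ba; last first.
      by have := ba.1; rewrite /olt; case: (a).
    pose e' s := e ((x : T) |` s)%fset.
    have e'mono : incr e' by move=> s s' ss'; apply: emono; exact: fsetUS.
    suff -> : P e a = P e' (inl x) by apply: IH => //; exact: ba.1.
    apply/seteqP; split=> i [s [sa is_]].
      exists (s `\ (x : T))%fset; split.
        move=> y; rewrite in_fsetD1 => /andP [yx /sa ya].
        have [yE|//] := le_eqVolt woK (succ_le woK ba ya).
        by case: yE yx => ->; rewrite eqxx.
      apply: le_trans is_ _; apply: emono; apply/fsubsetP => y ys.
      by rewrite in_fset1U in_fsetD1 ys andbT orbN.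
    exists ((x : T) |` s)%fset; split=> // y; rewrite in_fset1U => /orP [/eqP ->|/sa].
      exact: ba.1.
    by move=> yx; exact: olt_trans woK _ _ _ yx ba.1.
  - apply: (lim_chain (P := P e) woK al) => [b|b c bc i [s [sb is_]]|i [s [sa is_]]|b ba].
    + exact: dirP.
    + by exists s; split=> // x /sb xb; exact: olt_le_trans woK _ _ _ xb bc.
    + suff [b ba sb] : exists2 b, olt leK b a & small_fset b s by exists b => //; exists s.
      have : forall r : seq T, (forall x, x \in r -> olt leK (inl (x : I)) a) ->
          exists2 b, olt leK b a & forall x, x \in r -> olt leK (inl (x : I)) b.
        elim=> [|x r IHr] ra; first by have [b ba] := al.1; exists b.
        have [|b ba rb] := IHr; first by move=> y yr; apply: ra; rewrite inE yr orbT.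
        have [c xc ca] := limit_next al (ra x (mem_head _ _)).
        have [d [da bd cd]] : exists d, [/\ olt leK d a, leK b d & leK c d].
          by have [?|?] := wo_total woK b c; [exists c|exists b]; split=> //; exact: wo_refl.
        exists d => // y; rewrite inE => /orP [/eqP ->|/rb yb].
          exact: olt_le_trans woK _ _ _ xc cd.
        exact: olt_le_trans woK _ _ _ yb bd.
      by move=> /(_ (enum_fset s)); apply.
    + exact: IH.
have := main (inr tt) e0 e0mono; congr (D (colim_mod _)); apply/seteqP; split=> // i _.
by exists [fset (i : T)]%fset; split=> //; apply: e0bound; rewrite in_fset1.
Qed.

End Good.
End Colim.

(** * Deconstructible classes *)
Section Deconstructible.
Variables (R : pzRingType) (mu : small) (D : rmodType R -> Prop).
Hypothesis mu_gt0 : card_lt void mu.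
Hypothesis dec : deconstructible mu D.
Let C (N : rmodType R) := lt_presented mu N /\ D N.

(** The functions on mu are a set that covers all the successive quotients of all
    filtrations at once. *)
Lemma lt_presented_surj (N : rmodType R) : lt_presented mu N ->
  exists s : (mu -> R) -> N, forall y, exists v, s v = y.
Proof.
move=> [X [_ [[/card_leT_inj [i ii] _] [_ [_ [g [gs _]]]]]]].
exists (fun v => g (insubd 0 (v \o i : X -> R^c^o))) => y.
have [x <-] := gs y.
exists (fun m => if pselect (exists z, i z = m) is left h
                 then (val x : X -> R^c^o) (sval (cid h)) else 0).
congr (g _); rewrite -[RHS](valKd 0); congr (insubd _ _).
apply: funext => z /=; case: pselect => [h|[]]; last by exists z.
by congr (_ _); apply: ii; exact: (svalP (cid h)).
Qed.

Lemma dec_iso A B : isomorphic A B -> D A -> D B.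
Proof. by move=> AB /dec /(filtered_iso AB) /dec. Qed.

Lemma dec_zero : D (zero_mod R).
Proof. by apply/dec/filtered_zero; exact: zero_mod0. Qed.

Lemma dec_zero_presented : upto_iso C (zero_mod R).
Proof.
exists (zero_mod R); last exact: iso_refl.
split; last exact: dec_zero.
have idl : linear (fun x : zero_mod R => x) by [].
exists void, void; split=> //; split=> //; exists (mklin idl), (mklin idl).
by split=> [z|x]; [exists z|split=> _; [exists x|exact: zero_mod0]].
Qed.

Lemma dec_prod (A B : rmodType R) : D A -> D B -> D (A * B)%type.
Proof.
by move=> /dec DA /dec DB; apply/dec/filtered_prod => //; exact: dec_zero_presented.
Qed.

Lemma dec_closed (M : rmodType R) : D M -> exists c : M -> (mu -> R) -> M,
  forall H : submodClosed M, (forall x v, x \in H -> c x v \in H) ->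
  D (smod H) /\ D (qmod H).
Proof.
move=> /dec DM; have [|c cP] := filtered_closed (V := mu -> R) dec_zero_presented _ DM.
  by move=> N [/lt_presented_surj].
by exists c => H /cP [DH DQ]; split; apply/dec.
Qed.

Hypothesis summands : closed_direct_summands D.

Section TotalSystem.
Variables (I : small) (le : rel I) (M : I -> rmodType R)
  (f : forall i j, le i j -> {linear M i -> M j}).

Lemma total_system : exists F : forall i j, {linear M i -> M j},
  forall i j (h : le i j) x, F i j x = f h x.
Proof.
have zl i j : linear (fun _ : M i => 0 : M j).
  by move=> r x y; rewrite scaler0 addr0.
exists (fun i j => if pselect (le i j) is left h then f h else mklin (zl i j)).
move=> i j h x; case: pselect => // h'; by rewrite (bool_irrelevance h' h).
Qed.
End TotalSystem.

Lemma AEC_closed_direct_limits k :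
  is_AEC D (le_emb D k) -> closed_direct_limits D.
Proof.
move=> [_ tv _ _]; have closed := tarski_vaught_chain_closed dec_iso tv.
move=> I le M f L phi sys [phic Luniv] DM.
have [F FE] := total_system f.
have [[le_refl le_tr] _] := dsys_poset sys.
have le_trans i j l : le i j -> le j l -> le i l by exact: le_tr.
have F_id i x : F i i x = x by rewrite (FE _ _ (le_refl i)) dsys_id.
have F_comp i j l x : le i j -> le j l -> F j l (F i j x) = F i l x.
  move=> ij jl; rewrite (FE _ _ ij) (FE _ _ jl) (FE _ _ (le_trans _ _ _ ij jl)); exact: (dsys_comp sys).
have dirT : updirected le setT.
  split; first by have [i _] := dsys_nonempty sys; exists i.
  by move=> i j _ _; have [l [il jl]] := dsys_directed sys i j; exists l.
have DL : D (colim_mod le F setT).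
  apply: (lim_directed le_refl le_trans F_id F_comp dec_iso _ DM dirT).
  move=> K leK top N G wo tl G_id G_comp DN Ns Nk.
  exact: (chain_limit dec_iso dec_zero dec_prod summands closed dec_closed
    wo tl G_id G_comp DN Ns Nk).
have [psi psiP] := lim_colim le_trans F_comp dirT.
have [u [uE _]] := Luniv _ psi (fun i j h x => etrans (congr1 (psi j) (esym (FE i j h x)))
  (colim_compat psiP x Logic.I Logic.I h)).
have [v vE] := colim_univ le_trans F_comp dirT psiP (psi := phi) (fun i j x _ _ h =>
  etrans (congr1 (phi j) (FE i j h x)) (phic i j h x)).
have [w [_ wuniq]] := Luniv _ phi phic.
have vu x : v (u x) = x.
  have idl : linear (fun x : L => x) by [].
  have vul : linear (v \o u) by move=> r y z; rewrite /= !linearP.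
  have := wuniq (mklin vul) (fun i y => etrans (congr1 v (uE i y)) (vE i y Logic.I)) x.
  by have := wuniq (mklin idl) (fun i y => erefl) x => /= <-.
apply: dec_iso DL; apply: iso_sym; exists u; exists v => // y.
have [i [_ [x <-]]] := colim_surj psiP y.
by rewrite vE // uE.
Qed.

End Deconstructible.

(** * Finite sequences over an infinite set *)

(** A maximal partial injection from X to Y exhausts X or Y. *)
Lemma inj_comparable (T : Type) (X Y : set T) :
  (exists f : T -> T, (forall x, X x -> Y (f x)) /\
     forall x x', X x -> X x' -> f x = f x' -> x = x') \/
  (exists f : T -> T, (forall y, Y y -> X (f y)) /\
     forall y y', Y y -> Y y' -> f y = f y' -> y = y').
Proof.
pose P (r : set (T * T)) := [/\ forall p, r p -> X p.1 /\ Y p.2,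
  forall x y y', r (x, y) -> r (x, y') -> y = y' &
  forall x x' y, r (x, y) -> r (x', y) -> x = x'].
have [F FP Ftot|r [[rXY rfun rinj] rmax]] := @Zorn_bigcup _ P.
  have two p q : (\bigcup_(Z in F) Z) p -> (\bigcup_(Z in F) Z) q ->
      exists Z, [/\ P Z, Z p & Z q].
    move=> [Z FZ Zp] [Z' FZ' Zq]; have [ZZ'|Z'Z] := Ftot _ _ FZ FZ'.
      by exists Z'; split=> //; [exact: FP|exact: ZZ'].
    by exists Z; split=> //; [exact: FP|exact: Z'Z].
  split=> [p [Z /FP [ZXY _ _] /ZXY]//|x y y' h h'|x x' y h h'].
    by have [Z [[_ Zf _] Zp Zq]] := two _ _ h h'; exact: Zf Zp Zq.
  by have [Z [[_ _ Zi] Zp Zq]] := two _ _ h h'; exact: Zi Zp Zq.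
have [domX|/existsNP [x /not_implyP [Xx nx]]] := pselect (forall x, X x -> exists y, r (x, y)).
  have /choice [f fP] : forall x, exists y, X x -> r (x, y).
    by move=> x; have [/domX [y xy]|nX] := pselect (X x); [exists y|exists x].
  left; exists f; split=> [x /fP /rXY [] //|x x' /fP xf /fP x'f e].
  by apply: rinj xf _; rewrite e.
right; have ranY y : Y y -> exists x, r (x, y).
  move=> Yy; apply: contrapT => ny; apply: (rmax (r `|` [set (x, y)])).
    split=> [p|]; first by left.
    by move=> /(_ (x, y) (or_intror erefl)) xy; apply: nx; exists y.
  split=> [p [/rXY//|->]//|x1 y1 y2|x1 x2 y1].
    move=> [h1|e1] [h2|e2]; first exact: rfun h1 h2.
    - by case: nx; exists y1; rewrite -[x](congr1 fst e2).
    - by case: nx; exists y2; rewrite -[x](congr1 fst e1).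
    - by rewrite [y1](congr1 snd e1) [y2](congr1 snd e2).
  move=> [h1|e1] [h2|e2]; first exact: rinj h1 h2.
  - by case: ny; exists x1; rewrite -[y](congr1 snd e2).
  - by case: ny; exists x2; rewrite -[y](congr1 snd e1).
  - by rewrite [x1](congr1 fst e1) [x2](congr1 fst e2).
have /choice [f fP] : forall y, exists x, Y y -> r (x, y).
  by move=> y; have [/ranY [x' xy]|nY] := pselect (Y y); [exists x'|exists y].
exists f; split=> [y /fP /rXY [] //|y y' /fP yf /fP y'f e].
by apply: rfun yf _; rewrite e.
Qed.

(** Consider the injections seq A -> A, for subsets A of T that contain the range
    of io, given by their graphs G, and a maximal one. If T minus A contained a
    copy B of A, then the injection could be extended to A + B: the sequences
    with an entry in B would be coded in B. So T minus A embeds in A, hence T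
    embeds in A, and seq T in seq A. Two different elements of A serve as tags
    to embed two copies of A in A. *)
Lemma seq_injection (T : eqType) (io : nat -> T) : injective io ->
  exists f : seq T -> T, injective f.
Proof.
move=> io_inj.
pose G0 := [set p : seq T * T | exists s, p = (map io s, io (choice.pickle s))].
pose supp (G : set (seq T * T)) x := exists y, G ([:: x], y).
pose over (G : set (seq T * T)) (s : seq T) := forall x, x \in s -> supp G x.
pose Q (G : set (seq T * T)) := [/\ G0 `<=` G,
  forall s y, G (s, y) -> over G s /\ supp G y,
  forall s, over G s -> exists y, G (s, y),
  forall s y y', G (s, y) -> G (s, y') -> y = y' &
  forall s s' y, G (s, y) -> G (s', y) -> s = s'].
have suppS G G' : G `<=` G' -> forall x, supp G x -> supp G' x.
  by move=> GG' x [y Gy]; exists y; exact: GG'.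
have G0Q : Q G0.
  have supp0 n : supp G0 (io n) by exists (io (choice.pickle [:: n])), [:: n].
  split=> // [_ _ [s [-> ->]]|s sG|s y y' [r [sE ->]] [r' [sE' ->]]|
              s s' y [r [-> yE]] [r' [-> yE']]].
  - by split=> // x /mapP [n _ ->].
  - have [r ->] : exists r, s = map io r.
      elim: s sG => [|x s IH] sG; first by exists [::].
      have [|r ->] := IH; first by move=> z zs; apply: sG; rewrite inE zs orbT.
      have [y [[|n [|m r']] //= [-> _]]] := sG x (mem_head _ _).
      by exists (n :: r).
    by exists (io (choice.pickle r)), r.
  - by congr (io (choice.pickle _)); apply: (inj_map io_inj); rewrite -sE.
  - by congr (map io _); apply: (pcan_inj choice.pickleK); apply: io_inj; rewrite -yE.
have [F FP Ftot|G [GQ Gmax]] := @Zorn_bigcup _ (fun G => G = set0 \/ Q G).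
  have [[Z0 FZ0 Q0]|none] := pselect (exists2 Z, F Z & Q Z); last first.
    left; apply/seteqP; split=> // p [Z FZ]; have [->//|QZ] := FP Z FZ.
    by case: none; exists Z.
  right; set U := \bigcup_(Z in F) Z.
  have FU Z : F Z -> Z `<=` U by move=> FZ p Zp; exists Z.
  have UQ p : U p -> exists Z, [/\ F Z, Q Z & Z p].
    by move=> [Z FZ Zp]; have [ZE|QZ] := FP Z FZ; [move: Zp; rewrite ZE|exists Z].
  have two Z Z' : F Z -> F Z' -> Q Z -> Q Z' -> exists Z'', [/\ F Z'', Q Z'', Z `<=` Z'' & Z' `<=` Z''].
    move=> FZ FZ' QZ QZ'; have [ZZ'|Z'Z] := Ftot _ _ FZ FZ'.
      by exists Z'; split.
    by exists Z; split.
  have twop p q : U p -> U q -> exists Z, [/\ Q Z, Z p & Z q].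
    move=> /UQ [Z [FZ QZ Zp]] /UQ [Z' [FZ' QZ' Zq]].
    have [Z'' [_ QZ'' s s']] := two _ _ FZ FZ' QZ QZ'.
    by exists Z''; split=> //; [exact: s|exact: s'].
  split.
  - by move=> p /(let: And5 h _ _ _ _ := Q0 in h); exact: FU.
  - move=> s y /UQ [Z [FZ [_ Zc _ _ _] Zsy]]; have [Zs Zy] := Zc _ _ Zsy.
    by split=> [x /Zs|]; [exact: (suppS _ _ (FU _ FZ))|exact: (suppS _ _ (FU _ FZ) _ Zy)].
  - move=> s sU; have [Z [FZ [_ _ Zt _ _] Zs]] : exists Z, [/\ F Z, Q Z & over Z s].
      elim: s sU => [|x s IH] sU; first by exists Z0; split.
      have [|Z [FZ QZ Zs]] := IH; first by move=> z zs; apply: sU; rewrite inE zs orbT.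
      have [y /UQ [Z' [FZ' QZ' Z'x]]] := sU x (mem_head _ _).
      have [Z'' [FZ'' QZ'' S S']] := two _ _ FZ FZ' QZ QZ'.
      exists Z''; split=> // z; rewrite inE => /orP [/eqP ->|/Zs].
        by exists y; exact: S'.
      exact: suppS.
    by have [y Zy] := Zt s Zs; exists y; exact: FU Zy.
  - move=> s y y' h h'; have [Z [[_ _ _ Zf _] Zp Zq]] := twop _ _ h h'.
    exact: Zf Zp Zq.
  - move=> s s' y h h'; have [Z [[_ _ _ _ Zi] Zp Zq]] := twop _ _ h h'.
    exact: Zi Zp Zq.
have {GQ} [G0G Gc Gt Gf Gi] : Q G.
  case: GQ => // GE; case: (Gmax G0); last by right.
  rewrite GE; split=> // /(_ ([::], io (choice.pickle ([::] : seq nat)))) []; last by exists [::].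
pose A := supp G.
have Aio n : A (io n) by apply: suppS G0G _ _; exists (io (choice.pickle [:: n])), [:: n].
have /choice [code codeP] : forall s, exists y, over G s -> G (s, y).
  by move=> s; have [/Gt [y sy]|ns] := pselect (over G s); [exists y|exists (io 0)].
have codeA s : over G s -> A (code s) by move=> /codeP /Gc [].
have code_inj s s' : over G s -> over G s' -> code s = code s' -> s = s'.
  by move=> /codeP sc /codeP s'c e; apply: Gi sc _; rewrite e.
have over2 x n : A x -> over G [:: x; io n].
  by move=> Ax z; rewrite !inE => /orP [] /eqP -> //; exact: Aio.
(* an injection of A + X into A, given one (called g) of X into A *)
pose enc (g : T -> T) x :=
  if pselect (A x) then code [:: x; io 0] else code [:: g x; io 1].
have encA (X : set T) g : (forall x, X x -> A (g x)) -> forall x, A x \/ X x -> A (enc g x).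
  move=> gA x; rewrite /enc; case: pselect => [Ax _|nA [//|Xx]].
    exact/codeA/over2.
  exact/codeA/over2/gA.
have enc_inj (X : set T) g : (forall x, X x -> A (g x)) ->
    (forall x x', X x -> X x' -> g x = g x' -> x = x') ->
    forall x x', A x \/ X x -> A x' \/ X x' -> enc g x = enc g x' -> x = x'.
  move=> gA g_inj x x'; rewrite /enc.
  case: pselect => [Ax _|nA [//|Xx]]; case: pselect => [Ax' _|nA' [//|Xx']].
  - by move=> /(code_inj _ _ (over2 _ _ Ax) (over2 _ _ Ax')) [].
  - by move=> /(code_inj _ _ (over2 _ _ Ax) (over2 _ _ (gA _ Xx'))) [_ /io_inj].
  - by move=> /(code_inj _ _ (over2 _ _ (gA _ Xx)) (over2 _ _ Ax')) [_ /io_inj].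
  - by move=> /(code_inj _ _ (over2 _ _ (gA _ Xx)) (over2 _ _ (gA _ Xx'))) [/g_inj]; apply.
have map_inj (X : set T) g : (forall x, X x -> A (g x)) ->
    (forall x x', X x -> X x' -> g x = g x' -> x = x') ->
    forall s s', (forall x, x \in s -> A x \/ X x) -> (forall x, x \in s' -> A x \/ X x) ->
    code (map (enc g) s) = code (map (enc g) s') -> s = s'.
  move=> gA g_inj s s' sX s'X.
  have ov r : (forall x, x \in r -> A x \/ X x) -> over G (map (enc g) r).
    by move=> rX _ /mapP [x /rX /(encA X g gA) Ax ->].
  move=> /(code_inj _ _ (ov s sX) (ov s' s'X)).
  elim: s s' sX s'X => [|x s IH] [|x' s'] //= sX s'X [/(enc_inj X g gA g_inj) xx' ss'].
  rewrite xx'; [|exact/sX/mem_head|exact/s'X/mem_head]; congr (_ :: _).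
  by apply: IH => // z zs; [apply: sX|apply: s'X]; rewrite inE zs orbT.
have [[b [bA b_inj]]|[g [gA g_inj]]] := inj_comparable A (~` A); last first.
  exists (fun s => code (map (enc g) s)) => s s'.
  by apply: (map_inj (~` A) g gA g_inj) => x _; exact: EM.
pose B := [set b x | x in A].
have [g gb] : exists g : T -> T, forall x, A x -> g (b x) = x.
  have /choice [g gP] : forall y, exists x, B y -> A x /\ b x = y.
    by move=> y; have [[x Ax <-]|nB] := pselect (B y); [exists x|exists (io 0)].
  exists g => x Ax; have [|Ag bg] := gP (b x); first by exists x.
  exact: b_inj bg.
have gA y : B y -> A (g y) by move=> [x Ax <-]; rewrite gb.
have g_inj y y' : B y -> B y' -> g y = g y' -> y = y'.
  by move=> [x Ax <-] [x' Ax' <-]; rewrite !gb // => ->.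
have BnA y : B y -> ~ A y by move=> [x Ax <-]; exact: bA.
pose G' := G `|` [set p | [/\ forall x, x \in p.1 -> A x \/ B x, ~ over G p.1 &
                             p.2 = b (code (map (enc g) p.1))]].
have encG s : (forall x, x \in s -> A x \/ B x) -> A (code (map (enc g) s)).
  by move=> sAB; apply: codeA => _ /mapP [x /sAB /(encA B g gA) Ax ->].
have suppG' x : supp G' x <-> A x \/ B x.
  split=> [[y [Gx|[/= AB _ _]]]|[Ax|Bx]].
  - by left; exists y.
  - by apply: AB; rewrite inE.
  - by apply: suppS Ax => p; left.
  - exists (b (code (map (enc g) [:: x]))); right; split=> //=.
      by move=> z; rewrite inE => /eqP ->; right.
    by move=> /(_ x (mem_head _ _)) /(BnA _ Bx).
case: (Gmax G').
  split=> [p|G'G]; first by left.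
  have Bb : B (b (io 0)) by exists (io 0).
  have [|y /G'G yG] := (suppG' (b (io 0))).2; first by right.
  by apply: (BnA _ Bb); exists y.
right; split.
- by move=> p /G0G; left.
- move=> s y [Gsy|[/= sAB _ ->]].
    have [Gs Gy] := Gc _ _ Gsy.
    by split=> [x /Gs Gx|]; apply/suppG'; left.
  split=> [x /sAB|]; first by move/suppG'.
  by apply/suppG'; right; exists (code (map (enc g) s)) => //; exact: encG.
- move=> s sG'; have [/Gt [y Gy]|nG] := pselect (over G s); first by exists y; left.
  by exists (b (code (map (enc g) s))); right; split=> //= x /sG' /suppG'.
- move=> s y y' [Gy|[/= _ ns ->]] [Gy'|[/= _ ns' ->]] //; first exact: Gf Gy Gy'.
  + by case: ns'; have [] := Gc _ _ Gy.
  + by case: ns; have [] := Gc _ _ Gy'.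
- move=> s s' y [Gy|[/= sAB ns yE]] [Gy'|[/= s'AB ns' yE']].
  + exact: Gi Gy Gy'.
  + have [_ Ay] := Gc _ _ Gy; case: (bA (code (map (enc g) s'))); first exact: encG.
    by rewrite -yE'.
  + have [_ Ay] := Gc _ _ Gy'; case: (bA (code (map (enc g) s))); first exact: encG.
    by rewrite -yE.
  + apply: (map_inj B g gA g_inj) => //; apply: b_inj; [exact: encG|exact: encG|].
    by rewrite -yE.
Qed.

(** * From direct limits to abstract elementary classes *)
Section LimitsToAEC.
Variables (R : pzRingType) (D : rmodType R -> Prop) (k : embedding_kind).
Hypothesis D_iso : forall A B, isomorphic A B -> D A -> D B.
Hypothesis D_lim : closed_direct_limits D.

(** One equation in one unknown gives the RD case. *)
Lemma pure_emb_rel (U : rmodType R) (A B : set U) :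
  emb_rel PureEmbeddings A B -> emb_rel k A B.
Proof.
case: k => //= pu r y yB yA.
have sE (z : 'I_1 -> U) i :
    \sum_(j < 1) ((const_mx (r : R) : 'M[R]_(1, 1)) i j : R^c) *: z j = r *: z ord0.
  by rewrite big_ord1 mxE.
have [i|i|x xA xE] := pu 1%N 1%N (const_mx r) (fun=> y); rewrite ?sE //.
by exists (x ord0); rewrite // -(sE x ord0) xE sE.
Qed.

Lemma union_direct_limit (U : rmodType R) (I : small) (le : rel I)
    (A : I -> submodClosed U) (V : submodClosed U) :
  wochoice.well_order le -> (forall i, D (smod (A i))) ->
  (forall i j, le i j -> {subset A i <= A j}) -> is_union A V -> D (smod V).
Proof.
move=> wo DA mono AV.
have inA i j (h : le i j) (x : smod (A i)) : smod_incl (A i) x \in A j.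
  exact: mono h _ (smod_in x).
have inV i (x : smod (A i)) : smod_incl (A i) x \in V.
  by apply/AV; exists i; exact: smod_in.
pose f i j (h : le i j) : {linear smod (A i) -> smod (A j)} := corestrict (inA i j h).
pose phi i : {linear smod (A i) -> smod V} := corestrict (inV i).
have fE i j h x : val (f i j h x) = val x by [].
have phiE i x : val (phi i x) = val x by [].
have [i0 _] : exists i, (0 : U) \in A i by apply/AV; exact: rpred0.
have sys : direct_system f.
  split.
  - split; last by move=> i j /andP [ij ji]; exact: wo_anti wo _ _ ij ji.
    by split=> [i|j i l]; [exact: wo_refl|exact: wo_trans].
  - by exists i0.
  - by move=> i j; have [ij|ji] := wo_total wo i j; [exists j|exists i];
      split=> //; exact: wo_refl.
  - by move=> i h x; apply: val_inj.
  - by move=> i j l hij hjl hil x; apply: val_inj.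
apply: (D_lim (phi := phi) sys _ DA).
split=> [i j h x|N psi compat]; first exact: val_inj.
have surj (y : smod V) : exists i x, phi i x = y.
  by have [i yi] := (AV _).1 (smod_in y); exists i, (Smod yi); apply: val_inj.
have zl i j : linear (fun _ : smod (A i) => 0 : smod (A j)).
  by move=> r x y; rewrite scaler0 addr0.
pose F i j : {linear smod (A i) -> smod (A j)} :=
  if pselect (le i j) is left h then f i j h else mklin (zl i j).
have FE i j (h : le i j) x : F i j x = f i j h x.
  by rewrite /F; case: pselect => // h'; apply: val_inj.
have dirT : updirected le setT.
  split=> [|i j _ _]; first by exists i0.
  by have [ij|ji] := wo_total wo i j; [exists j|exists i]; split=> //; exact: wo_refl.
have colimV : colim le F setT phi.
  split=> [i j x _ _ h|y|i x _ /(congr1 val) x0]; first by rewrite (FE _ _ h); apply: val_inj.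
    by have [i [x xy]] := surj y; exists i; split=> //; exists x.
  exists i; split=> //; first exact: wo_refl.
  by rewrite (FE _ _ (wo_refl wo i)); apply: val_inj; exact: x0.
have F_comp i j l x : le i j -> le j l -> F j l (F i j x) = F i l x.
  move=> ij jl; rewrite (FE _ _ ij) (FE _ _ jl) (FE _ _ (wo_trans wo ij jl)).
  exact: val_inj.
have [|u uE] := colim_univ (@wo_trans _ _ wo) F_comp dirT colimV (psi := psi).
  by move=> i j x _ _ h; rewrite (FE _ _ h) compat.
exists u; split=> [i x|v vE y]; first exact: uE.
by have [i [x <-]] := surj y; rewrite vE uE.
Qed.

Lemma limits_tarski_vaught : tarski_vaught D (le_emb D k).
Proof.
move=> U I le A V [wo DA str cont] AV.
have str' i j : le i j -> [/\ {subset A i <= A j}, D (smod (A i)), D (smod (A j)) &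
    emb_rel k [set` A i] [set` A j]].
  by move=> /str /(strong_inE _ D_iso).
have mono i j : le i j -> {subset A i <= A j} by move=> /str' [].
have DV : D (smod V) by exact: union_direct_limit wo DA mono AV.
have AVs i : {subset A i <= V} by move=> x xi; apply/AV; exists i.
have tot := wo_total wo.
have monoS i j : le i j -> [set` A i] `<=` [set` A j] by move=> /mono h x; exact: h.
have embA i j : le i j -> emb_rel k [set` A i] [set` A j] by move=> /str' [].
split=> // [j|N DN AN]; apply/(strong_inE _ D_iso); split=> //.
- exact: (chain_emb_union (A := fun i => [set` A i]) j tot monoS embA AV).
- by move=> x /AV [i xi]; have [h _] := AN i; exact: h.
- have [i0 _] : exists i, (0 : U) \in A i by apply/AV; exact: rpred0.
  apply: (union_emb (A := fun i => [set` A i]) i0 tot monoS _ AV) => i.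
  by have /(strong_inE _ D_iso) [] := AN i.
Qed.

Lemma le_emb_abstract_class : abstract_class D (le_emb D k).
Proof.
split.
- exact: D_iso.
- by move=> B A [].
- move=> B B' A A' f fb AA' [DA DB /embeddingE e]; split.
  + apply: D_iso DA; apply: (iso_range (h := f \o smod_incl A)) => [a a0|x].
      by apply: val_inj; apply: (bij_inj fb); rewrite linear0; exact: a0.
    have [g fK gK] := fb; split=> [xA'|[a <-]]; last by rewrite AA'; exact: smod_in.
    have gA : g x \in A by rewrite -AA' gK.
    by exists (Smod gA); rewrite /= gK.
  + by apply: D_iso DB; exists f.
  + by apply/embeddingE; apply: emb_rel_iso fb _ e => x /=; rewrite AA'.
- move=> U A DA; apply/(strong_inE _ D_iso); split=> //; exact: emb_rel_refl.
- by move=> U A B [AB _] [BA _] x; apply/idP/idP => [/AB|/BA].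
- move=> U A B C /(strong_inE _ D_iso) [AB DA _ e] /(strong_inE _ D_iso) [BC _ DC e'].
  apply/(strong_inE _ D_iso); split=> // [x /AB /BC //|].
  exact: emb_rel_trans AB e e'.
Qed.

Lemma le_emb_coherence : coherence D (le_emb D k).
Proof.
move=> U A B C DA DB DC /(strong_inE _ D_iso) [_ _ _ e] /(strong_inE _ D_iso) [BC _ _ _] AB.
by apply/(strong_inE _ D_iso); split=> //; apply: emb_rel_sub e.
Qed.

Variable V : small.
Hypothesis D_closed : forall N : rmodType R, D N -> exists c : N -> V -> N,
  forall H : submodClosed N, (forall x v, x \in H -> c x v \in H) -> D (smod H).

(** The operations under which a submodule is to be closed: those of modules, the
    function c of the hypothesis D_closed in order to belong to D, and choices
    of solutions of finite systems in order to be pure. *)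
Inductive operation :=
  | Sum | Scalar of R | Hill of V
  | Solve (m n : nat) of 'M[R]_(m, n) & 'I_n.

(** The submodule generated by A under these operations is the set of values of
    terms with leaves in A, and terms can be coded by finite sequences. *)
Lemma le_emb_LST : lowenheim_skolem_tarski D (le_emb D k).
Proof.
pose lambda : small := (operation + nat)%type.
exists lambda => B A DB; have [c cP] := D_closed DB.
pose solves m n (a : 'M[R]_(m, n)) (s : seq B) (x : 'I_n -> B) :=
  forall i : 'I_m, \sum_(j < n) (a i j : R^c) *: x j = s`_i.
pose op (l : operation) (s : seq B) : B :=
  match l with
  | Sum => s`_0 + s`_1
  | Scalar r => (r : R^c) *: s`_0
  | Hill v => c s`_0 v
  | Solve m n a j => if pselect (exists x, solves m n a s x) is left h
                     then sval (cid h) j else 0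
  end.
pose ev := eval 0 (val : smod A -> B) op.
pose P u := exists t, ev t = u.
have Pop l s : (forall x, x \in s -> P x) -> P (op l s).
  by move=> /eval_seq [ts <-]; exists (app l ts).
have P1 u : P u -> forall x, x \in [:: u] -> P x by move=> Pu x; rewrite inE => /eqP ->.
have P0 : P 0 by exists (GenTree.Node 0 [::]).
have Pl r x y : P x -> P y -> P (r *: x + y).
  move=> Px Py; apply: (Pop Sum [:: r *: x; y]) => z.
  rewrite !inE => /orP [] /eqP -> //.
  exact: (Pop (Scalar r) [:: x] (P1 x Px)).
pose H := psub P0 Pl; have HE x : x \in H <-> P x by exact: psubE.
have AH : {subset A <= H}.
  by move=> x xA; apply/HE; exists (GenTree.Leaf (inl (Smod xA))).
have DH : D (smod H).
  by apply: cP => x v /HE /P1 Px; apply/HE; exact: (Pop (Hill v) [:: x]).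
exists H; split=> //.
  split=> //; apply/embeddingE/pure_emb_rel => m n a x _ xA.
  pose s := [seq \sum_(j < n) (a i j : R^c) *: x j | i <- enum 'I_m].
  have sE (i : 'I_m) : s`_i = \sum_(j < n) (a i j : R^c) *: x j.
    by rewrite (nth_map i) ?size_enum_ord // nth_ord_enum.
  have sP z : z \in s -> P z by move=> /mapP [i _ ->]; apply/HE; exact: xA.
  have sol : exists y, solves m n a s y by exists x => i; rewrite sE.
  exists (fun j => op (Solve a j) s) => [j|i]; first by apply/HE; exact: Pop.
  rewrite -sE /=; case: pselect => [h|[]//]; exact: (svalP (cid h)).
have evH t : ev t \in H by apply/HE; exists t.
have surj : [set: smod H] #<= [set: term (smod A) operation].
  apply: (surj_card_leT (f := fun t => Smod (evH t))) => y.
  by have [t ty] := (HE _).1 (smod_in y); exists t; apply: val_inj.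
pose Z := classicType (smod A + lambda).
have [|code code_inj] := @seq_injection Z (fun n => inr (inr n)).
  by move=> m n [].
pose g (p : nat + (smod A + operation)) : Z :=
  match p with
  | inl n => inr (inr n)
  | inr (inl a) => inl a
  | inr (inr l) => inr (inl l)
  end.
have g_inj : injective g by move=> [n|[a|l]] [n'|[a'|l']] //= [->].
apply: card_le_trans surj _.
apply: (inj_card_leT (f := fun t => code (map g (GenTree.encode t)))) => t t'.
by move=> /code_inj /(inj_map g_inj) /(pcan_inj (GenTree.codeK _)).
Qed.

Lemma limits_AEC : is_AEC D (le_emb D k).
Proof.
split; [exact: le_emb_abstract_class|exact: limits_tarski_vaught|
        exact: le_emb_coherence|exact: le_emb_LST].
Qed.

End LimitsToAEC.

(** * The equivalence *)

Theorem corollary2p11 (R : pzRingType) (kappa kappa_succ : small)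
    (kappa_ge : [set: (R + nat)%type] #<= [set: kappa])
    (kappa_succP : is_succ_card kappa kappa_succ)
    (D : rmodType R -> Prop)
    (D_deconstructible : deconstructible kappa_succ D)
    (D_summands : closed_direct_summands D) :
  (forall k : embedding_kind,
     is_AEC D (le_emb D k) <-> closed_direct_limits D) /\
  (forall k k' : embedding_kind,
     is_AEC D (le_emb D k) <-> is_AEC D (le_emb D k')).
Proof.
have gt0 : card_lt void kappa_succ.
  have le0 (X : small) : [set: void] #<= [set: X].
    by apply: (inj_card_leT (f := fun v : void => match v with end)) => -[].
  split=> // succ_le0; apply: kappa_succP.1.2.
  exact: card_le_trans succ_le0 (le0 kappa).
have main k : is_AEC D (le_emb D k) <-> closed_direct_limits D.
  split=> [|DL].
    exact: (AEC_closed_direct_limits gt0 D_deconstructible D_summands).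
  apply: (limits_AEC (V := kappa_succ -> R) k (dec_iso D_deconstructible) DL).
  move=> N /(dec_closed gt0 D_deconstructible) [c cP].
  by exists c => H /cP [].
by split=> // k k'; rewrite (main k) (main k').
Qed.
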